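(* Let $G$ be a locally compact group which has a compact open subgroup. Then $\mathcal P(G)$ is a multiplier Hopf $^*$-subalgebra of $C_0(G)$ which separates the points of $G$ and which is invariant under the left and right actions $f\mapsto {}_xf$ and $f\mapsto f_x$ ($x\in G$), where ${}_xf(y)=f(x^{-1}y)$ and $f_x(y)=f(yx)$.
   Context: $C_0(G)$ denotes the continuous complex functions on $G$ vanishing at infinity. A multiplier Hopf $^*$-subalgebra of $C_0(G)$ is a $^*$-subalgebra $\mathcal A\subseteq C_0(G)$ which is invariant under the antipode $S(f)(x)=f(x^{-1})$ and satisfies $\operatorname{span}\{\Delta(f)(1\otimes g)\mid f,g\in\mathcal A\}=\mathcal A\otimes\mathcal A$, where $\Delta(f)(1\otimes g)$ is the function $(x,y)\mapsto f(xy)g(y)$ and $\mathcal A\otimes\mathcal A$ is the space of finite sums of functions $(x,y)\mapsto a(x)b(y)$ with $a,b\in\mathcal A$. For a compact group $H$, $\mathcal P(H)$ is the set of $f\in C(H)$ for which there are finitely many $f_i,g_i\in C(H)$ with $f(hk)=\sum_i f_i(h)g_i(k)$ for all $h,k\in H$. $\mathcal P(G)$ is the set of $f\in C_c(G)$ such that for some compact open subgroup $H$ of $G$ there exist finitely many $f_i\in C_c(G)$ and $\phi_i\in C(H)$ with $f(xh)=\sum_i f_i(x)\phi_i(h)$ for all $x\in G,h\in H$. *)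

(* Defs.v *)
From HB Require Import structures.
From mathcomp Require Import all_boot all_order all_algebra.
From mathcomp Require Import all_classical all_reals all_analysis.
From mathcomp.real_closed Require Import complex.
Import Order.TTheory GRing.Theory Num.Theory numFieldTopology.Exports.

Set Implicit Arguments.
Unset Strict Implicit.
Unset Printing Implicit Defensive.

Local Open Scope ring_scope.
Local Open Scope classical_set_scope.

(* The complex numbers, built over a real type R, with their norm topology. *)
Definition CC (R : realType) : numClosedFieldType := R[i].

(* A topological group: a topological space G with a group law
   (mul, inv, one) such that multiplication G x G -> G and inversion
   are continuous. *)
Definition is_topological_group (G : topologicalType)
  (mul : G -> G -> G) (inv : G -> G) (one : G) : Prop :=
  [/\ (forall x y z, mul x (mul y z) = mul (mul x y) z),
      (forall x, mul one x = x /\ mul x one = x),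
      (forall x, mul (inv x) x = one /\ mul x (inv x) = one),
      continuous (fun p : G * G => mul p.1 p.2) &
      continuous inv].

(* Locally compact group (Hausdorff, as is standard). *)
Definition is_locally_compact_group (G : topologicalType)
  (mul : G -> G -> G) (inv : G -> G) (one : G) : Prop :=
  [/\ is_topological_group mul inv one, hausdorff_space G &
      locally_compact [set: G]].

Definition is_subgroup (G : topologicalType)
  (mul : G -> G -> G) (inv : G -> G) (one : G) (H : set G) : Prop :=
  [/\ H one, (forall x y, H x -> H y -> H (mul x y)) &
      (forall x, H x -> H (inv x))].

Definition is_compact_open_subgroup (G : topologicalType)
  (mul : G -> G -> G) (inv : G -> G) (one : G) (H : set G) : Prop :=
  [/\ is_subgroup mul inv one H, compact H & open H].

(* C_0(G): continuous complex functions vanishing at infinity. *)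
Definition C0 (R : realType) (G : topologicalType) : set (G -> CC R) :=
  [set f : G -> CC R | continuous f /\
    forall eps : R, 0 < eps ->
      exists K : set G, compact K /\ forall x, ~ K x -> `|f x| < ((eps%:C)%C : CC R)].

(* C_c(G): continuous complex functions with compact support. *)
Definition Cc (R : realType) (G : topologicalType) : set (G -> CC R) :=
  [set f : G -> CC R | continuous f /\ compact (closure [set x | f x != 0])].

(* P(G): f in C_c(G) such that for some compact open subgroup H there are
   finitely many f_i in C_c(G) and phi_i in C(H) with
   f(xh) = sum_i f_i(x) phi_i(h) for all x in G, h in H.
   An element of C(H) is represented by a function G -> C continuous on H
   (its values off H are irrelevant). *)
Definition PG (R : realType) (G : topologicalType)
  (mul : G -> G -> G) (inv : G -> G) (one : G) : set (G -> CC R) :=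
  [set f | Cc f /\
    exists H : set G, is_compact_open_subgroup mul inv one H /\
    exists (n : nat) (fi phi : 'I_n -> G -> CC R),
      (forall i, Cc (fi i) /\ {within H, continuous (phi i)}) /\
      forall x h, H h -> f (mul x h) = \sum_(i < n) fi i x * phi i h].

(* A *-subalgebra of the algebra of complex functions on G
   (pointwise operations, complex conjugation as involution). *)
Definition is_star_subalgebra (R : realType) (G : Type) (A : set (G -> CC R)) : Prop :=
  [/\ A (fun _ => 0),
      (forall f g, A f -> A g -> A (fun x => f x + g x)),
      (forall (c : CC R) f, A f -> A (fun x => c * f x)),
      (forall f g, A f -> A g -> A (fun x => f x * g x)) &
      (forall f, A f -> A (fun x => (f x)^*))].

(* A (x) A : finite sums of (x,y) |-> a(x) b(y), a, b in A. *)
Definition alg_tensor (R : realType) (G : Type) (A : set (G -> CC R))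
  : set (G -> G -> CC R) :=
  [set F | exists (n : nat) (a b : 'I_n -> G -> CC R),
     (forall i, A (a i) /\ A (b i)) /\
     F = (fun x y => \sum_(i < n) a i x * b i y)].

(* span { Delta(f)(1 (x) g) | f, g in A }, where
   Delta(f)(1 (x) g) = (x,y) |-> f(xy) g(y). *)
Definition delta_span (R : realType) (G : Type) (mul : G -> G -> G)
  (A : set (G -> CC R)) : set (G -> G -> CC R) :=
  [set F | exists (n : nat) (c : 'I_n -> CC R) (f g : 'I_n -> G -> CC R),
     (forall i, A (f i) /\ A (g i)) /\
     F = (fun x y => \sum_(i < n) c i * (f i (mul x y) * g i y))].

(* Multiplier Hopf *-subalgebra of C_0(G). *)
Definition is_multiplier_hopf_star_subalgebra (R : realType) (G : topologicalType)
  (mul : G -> G -> G) (inv : G -> G) (A : set (G -> CC R)) : Prop :=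
  [/\ A `<=` @C0 R G,
      is_star_subalgebra A,
      (forall f, A f -> A (fun x => f (inv x))) &
      delta_span mul A = alg_tensor A].

Definition separates_points (R : realType) (G : Type) (A : set (G -> CC R)) : Prop :=
  forall x y : G, x <> y -> exists f, A f /\ f x <> f y.

(* Main.v *)
Require Import Defs.
From HB Require Import structures.
From mathcomp Require Import all_boot all_order all_algebra.
From mathcomp Require Import all_classical all_reals all_analysis.
From mathcomp.real_closed Require Import complex.
From mathcomp Require Import ring lra zify.
Import Order.TTheory GRing.Theory Num.Theory numFieldTopology.Exports.
Import numFieldNormedType.Exports.
Local Open Scope ring_scope.
Local Open Scope classical_set_scope.

Set Implicit Arguments.
Unset Strict Implicit.
Unset Printing Implicit Defensive.

(** The only analytic input is the separation of points of a compact group [K] by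
    representative functions. Averages of left translates of a continuous function
    have arbitrarily small oscillation, which yields an invariant mean on [C(K)]
    and, applied to [K * K], Fubini's theorem for it. For a symmetric continuous
    [chi != 0], the convolution powers [chi^(2n+2) / lam^(n+1)] converge uniformly,
    for a suitable [lam > 0], to an eigenfunction [p != 0] of convolution by
    [chi * chi]; by Bessel's inequality the eigenspace is finite dimensional, so
    [p(xy)] is a finite sum of products. Taking [chi = theta~ * theta] with
    [theta(x) = alpha(hx) - alpha(x)], the function [alpha * p] has the same
    property and is not invariant under translation by [h].

    For the algebra, a kernel [k(x, y)] of finite rank is a finite sum of products
    [a(x) b(y)] with [a] and [b] in the spans of the sections of [k]. Hence
    [f] in [C_c(G)] lies in [P(G)] as soon as [f(xh)], restricted to [h] in some
    compact open subgroup, has finite rank, with no continuity requirement; and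
    both inclusions in [span Delta(A)(1 (x) A) = A (x) A] reduce to the finite rank
    of [f(xy) g(y)] and [f(x y^-1) g(y)], which holds because the support of [g]
    meets finitely many cosets. *)

(** * Continuity, averages and oscillation *)

Lemma cts_comp (X Y Z : topologicalType) (f : Y -> Z) (g : X -> Y) :
  continuous f -> continuous g -> continuous (fun x => f (g x)).
Proof. by move=> cf cg x; apply: (@continuous_comp _ _ _ g f); [exact: cg|exact: cf]. Qed.

Lemma cts_pair (X Y Z : topologicalType) (f : X -> Y) (g : X -> Z) :
  continuous f -> continuous g -> continuous (fun x => (f x, g x)).
Proof. by move=> cf cg x; apply: cvg_pair; [exact: cf|exact: cg]. Qed.

Lemma cts_id (X : topologicalType) : continuous (fun x : X => x).
Proof. by move=> x; exact: cvg_id. Qed.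

Lemma cts_cst (X Y : topologicalType) (y : Y) : continuous (fun _ : X => y).
Proof. by move=> x; exact: cvg_cst. Qed.

Lemma cts_fst (X Y Z : topologicalType) (f : X -> Y * Z) :
  continuous f -> continuous (fun x => (f x).1).
Proof. by move=> cf x; apply: (@continuous_comp _ _ _ f fst); [exact: cf|exact: cvg_fst]. Qed.

Lemma cts_snd (X Y Z : topologicalType) (f : X -> Y * Z) :
  continuous f -> continuous (fun x => (f x).2).
Proof. by move=> cf x; apply: (@continuous_comp _ _ _ f snd); [exact: cf|exact: cvg_snd]. Qed.

Section Arith.
Variables (F : numFieldType) (X : topologicalType).
Implicit Types f g : X -> F.

Lemma ctsD f g : continuous f -> continuous g -> continuous (fun x => f x + g x).
Proof. by move=> cf cg x; apply: cvgD; [exact: cf|exact: cg]. Qed.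

Lemma ctsM f g : continuous f -> continuous g -> continuous (fun x => f x * g x).
Proof. by move=> cf cg x; apply: cvgM; [exact: cf|exact: cg]. Qed.

Lemma ctsN f : continuous f -> continuous (fun x => - f x).
Proof. by move=> cf x; apply: cvgN; exact: cf. Qed.

Lemma cts_sum (I : Type) (r : seq I) (f : I -> X -> F) :
  (forall i, continuous (f i)) -> continuous (fun x => \sum_(i <- r) f i x).
Proof.
move=> cf; elim: r => [|a r IH].
  under eq_fun do rewrite big_nil. exact: cts_cst.
under eq_fun do rewrite big_cons. exact: ctsD.
Qed.

End Arith.

Lemma cts_mul (X K : topologicalType) (mul : K -> K -> K) (f g : X -> K) :
  continuous (fun p : K * K => mul p.1 p.2) ->
  continuous f -> continuous g -> continuous (fun x => mul (f x) (g x)).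
Proof.
move=> cm cf cg.
exact: (@cts_comp _ _ _ (fun p : K * K => mul p.1 p.2) (fun x => (f x, g x)) cm (cts_pair cf cg)).
Qed.

Ltac cts := lazymatch goal with
 | H : continuous ?f |- continuous ?f => exact: H
 | |- continuous (fun x => x) => exact: cts_id
 | |- continuous (fun _ => ?c) => exact: cts_cst
 | |- continuous (fun x => @?f x + @?g x) => apply: (@ctsD _ _ f g); cts
 | |- continuous (fun x => - @?f x) => apply: (@ctsN _ _ f); cts
 | |- continuous (fun x => @?f x * @?g x) => apply: (@ctsM _ _ f g); cts
 | |- continuous (fun x => (@?f x, @?g x)) => apply: (@cts_pair _ _ _ f g); cts
 | |- continuous (fun x => (@?f x).1) => apply: (@cts_fst _ _ _ f); cts
 | |- continuous (fun x => (@?f x).2) => apply: (@cts_snd _ _ _ f); cts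
 | |- continuous (fun x => \sum_(i <- _) _) => apply: cts_sum => ?; cts
 | H : continuous (fun p => ?m p.1 p.2) |- continuous (fun x => ?m (@?f x) (@?g x)) =>
     apply: (@cts_mul _ _ m f g H); cts
 | H : continuous ?f |- continuous (fun x => ?f (@?g x)) =>
     apply: (@cts_comp _ _ _ f g H); cts
 | |- _ => try solve [auto]
 end.

Section Average.
Variables (R : realType) (T : Type).
Implicit Types (s : seq T) (f g : T -> R).

(** The empty list has average 0, hence the nonemptiness conditions that accompany every list
    below. *)
Definition avg s f : R := (\sum_(a <- s) f a) / (size s)%:R.

Lemma eq_avg s f g : f =1 g -> avg s f = avg s g.
Proof. by move=> e; congr (_ / _); apply: eq_bigr => i _. Qed.

Lemma avgD s f g : avg s (fun a => f a + g a) = avg s f + avg s g.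
Proof. by rewrite /avg big_split mulrDl. Qed.

Lemma avgZ s c f : avg s (fun a => c * f a) = c * avg s f.
Proof. by rewrite /avg -mulr_sumr mulrA. Qed.

Lemma avg_le s f g : (forall a, f a <= g a) -> avg s f <= avg s g.
Proof. by move=> h; rewrite ler_wpM2r ?invr_ge0//; apply: ler_sum. Qed.

Lemma size_neq0 s : s <> [::] -> (size s)%:R != 0 :> R.
Proof. by case: s => // a s _; rewrite pnatr_eq0. Qed.

Lemma avg_cst s c : s <> [::] -> avg s (fun _ => c) = c.
Proof.
move=> s0; rewrite /avg big_const_seq count_predT iter_addr_0 -[c *+ _]mulr_natr mulfK//.
exact: size_neq0.
Qed.

Lemma avg_near s f c e : s <> [::] -> (forall a, `|f a - c| <= e) -> `|avg s f - c| <= e.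
Proof.
move=> s0 h; rewrite ler_distl; apply/andP; split.
- rewrite -(@avg_cst s (c - e))//; apply: avg_le => a.
  by have := h a; rewrite ler_distl => /andP[].
- rewrite -(@avg_cst s (c + e))//; apply: avg_le => a.
  by have := h a; rewrite ler_distl => /andP[].
Qed.
End Average.

Section AverageMap.
Variable R : realType.

Lemma avg_map (S T : Type) (h : S -> T) (s : seq S) (f : T -> R) :
  avg (map h s) f = avg s (fun a => f (h a)).
Proof. by rewrite /avg size_map big_map. Qed.

Lemma avg_allpairs (S T U : Type) (h : S -> T -> U) (s : seq S) (t : seq T) (f : U -> R) :
  avg (allpairs h s t) f = avg s (fun a => avg t (fun b => f (h a b))).
Proof.
rewrite /avg size_allpairs big_allpairs_dep natrM invfM mulrA [_ / _ / _]mulrAC.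
by rewrite -mulr_suml mulrAC.
Qed.

Lemma avg_swap (S T : Type) (s : seq S) (t : seq T) (f : S -> T -> R) :
  avg s (fun a => avg t (fun b => f a b)) = avg t (fun b => avg s (fun a => f a b)).
Proof.
rewrite /avg -!mulr_suml exchange_big /=.
by rewrite mulrAC.
Qed.

Lemma allpairs_neq0 (S T U : Type) (h : S -> T -> U) (s : seq S) (t : seq T) :
  s <> [::] -> t <> [::] -> allpairs h s t <> [::].
Proof. by case: s t => [//|a s] [//|b t]. Qed.
End AverageMap.

(* [compact_cover] needs a pointed space; the filter of large finite sets
   gives the same conclusion from near coverings. *)
Lemma compact_finite_nbhs (T : topologicalType) (A : set T) (U : T -> set T) :
  compact A -> (forall x, A x -> nbhs x (U x)) ->
  exists b : seq T, forall x, A x -> exists2 a, a \in b & U a x.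
Proof.
move=> /compact_near_coveringP cA hU.
pose F : set_system (seq T) := fun S => exists b : seq T, forall c : seq T, {subset b <= c} -> S c.
have FF : Filter F.
  split=> [|P Q [b hb] [c hc]|P Q PQ [b hb]].
  - by exists [::].
  - exists (b ++ c) => d hd; split.
      by apply: hb => x xb; apply: hd; rewrite mem_cat xb.
    by apply: hc => x xc; apply: hd; rewrite mem_cat xc orbT.
  - by exists b => c /hb /PQ.
have [|b hb] := cA _ F (fun c x => exists2 a, a \in c & U a x) FF.
  move=> x Ax; exists (U x, [set c : seq T | x \in c]).
    split; first exact: hU.
    by exists [:: x] => c; apply; rewrite mem_head.
  by move=> [y c] /= [Uy xc]; exists x.
by exists b; apply: hb.
Qed.

Section Compact.
Variables (R : realType).

(** A tube lemma: each [(y, x)] has a neighbourhood on which the difference is small, and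
    compactness of [Y] makes the neighbourhood of [x] uniform in [y]. *)
Lemma cts_near_diff (X Y : topologicalType) (F : X * Y -> R) (x : X) (e : R) :
  compact [set: Y] -> continuous F -> 0 < e ->
  \forall x' \near x, forall y, `|F (x', y) - F (x, y)| < e.
Proof.
move=> cY cF e0.
pose P x' y := `|F (x', y) - F (x, y)| < e.
suff: \forall x' \near x, [set: Y] `<=` P x'.
  by apply: filterS => x' h y; exact: h.
move/compact_near_coveringP: cY; apply => y _.
pose G (p : Y * X) := `|F (p.2, p.1) - F (x, p.1)|.
have cG : continuous G.
  apply: (@cts_comp _ _ _ (fun r : R => `|r|)); first exact: norm_continuous.
  cts.
have := cG (y, x).
move=> /(_ (fun r => r < e)); rewrite /= {1}/G /= subrr normr0.
apply; apply: open_nbhs_nbhs; split => //; exact: open_lt.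
Qed.
End Compact.

Section OscDefs.
Variables (R : realType) (K : Type) (mul : K -> K -> K).

(** The constant [c] is a uniform limit of averages of left translates of [f], as in von Neumann's
    construction of the mean. *)
Definition lmean (f : K -> R) (c : R) := forall e, 0 < e ->
  exists s, s <> [::] /\ forall x, `|avg s (fun a => f (mul a x)) - c| <= e.
Definition rmean (f : K -> R) (c : R) := forall e, 0 < e ->
  exists s, s <> [::] /\ forall x, `|avg s (fun a => f (mul x a)) - c| <= e.
End OscDefs.

Section GroupLaws.
Variables (K : topologicalType) (mul : K -> K -> K) (inv : K -> K) (one : K).
Hypothesis Hg : is_topological_group mul inv one.

Lemma tg_mulA x y z : mul x (mul y z) = mul (mul x y) z.
Proof. by case: Hg. Qed.

Lemma tg_mul1g x : mul one x = x.
Proof. by case: Hg => _ /(_ x)[]. Qed.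

Lemma tg_mulg1 x : mul x one = x.
Proof. by case: Hg => _ /(_ x)[]. Qed.

Lemma tg_mulVg x : mul (inv x) x = one.
Proof. by case: Hg => _ _ /(_ x)[]. Qed.

Lemma tg_mulgV x : mul x (inv x) = one.
Proof. by case: Hg => _ _ /(_ x)[]. Qed.

Lemma tg_mul_cts : continuous (fun p : K * K => mul p.1 p.2).
Proof. by case: Hg. Qed.

Lemma tg_inv_cts : continuous inv.
Proof. by case: Hg. Qed.

Lemma tg_mulgK x y : mul (mul x y) (inv y) = x.
Proof. by rewrite -tg_mulA tg_mulgV tg_mulg1. Qed.

Lemma tg_mulgVK x y : mul (mul x (inv y)) y = x.
Proof. by rewrite -tg_mulA tg_mulVg tg_mulg1. Qed.

Lemma tg_mulKg x y : mul (inv x) (mul x y) = y.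
Proof. by rewrite tg_mulA tg_mulVg tg_mul1g. Qed.

Lemma tg_mulVKg x y : mul x (mul (inv x) y) = y.
Proof. by rewrite tg_mulA tg_mulgV tg_mul1g. Qed.

Lemma tg_invM x y : inv (mul x y) = mul (inv y) (inv x).
Proof.
have e : mul (mul x y) (mul (inv y) (inv x)) = one by rewrite tg_mulA tg_mulgK tg_mulgV.
by rewrite -[LHS]tg_mulg1 -e tg_mulA tg_mulVg tg_mul1g.
Qed.

Lemma tg_invK x : inv (inv x) = x.
Proof. by rewrite -[LHS]tg_mulg1 -(tg_mulVg x) tg_mulA tg_mulVg tg_mul1g. Qed.
End GroupLaws.

Section Osc.
Variables (R : realType) (K : topologicalType).
Variables (mul : K -> K -> K) (inv : K -> K) (one : K).
Hypothesis Hg : is_topological_group mul inv one.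
Hypothesis cK : compact [set: K].
Let mulA := tg_mulA Hg.
Let mul1 := tg_mul1g Hg.
Let mulg1 := tg_mulg1 Hg.
Let mulV := tg_mulVg Hg.
Let cmul : continuous (fun p : K * K => mul p.1 p.2) := tg_mul_cts Hg.
Let cinv : continuous inv := tg_inv_cts Hg.

Lemma unif_cts (f : K -> R) e : continuous f -> 0 < e ->
  \forall v \near one, forall x, `|f (mul x v) - f x| < e.
Proof.
move=> cf e0.
have := @cts_near_diff R K K (fun p => f (mul p.2 p.1)) one e cK _ e0.
have c : continuous (fun p : K * K => f (mul p.2 p.1)) by cts.
by move=> /(_ c); apply: filterS => v h y; have := h y; rewrite /= mulg1.
Qed.

Lemma finite_cover (V : set K) : nbhs one V ->
  exists b : seq K, forall x, exists2 a, a \in b & V (mul (inv a) x).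
Proof.
move=> V1.
have hV a : [set: K] a -> nbhs a ((fun x => mul (inv a) x) @^-1` V).
  have c : continuous (fun x => mul (inv a) x) by cts.
  by move=> _; apply: (c a); rewrite mulV.
by have [b hb] := compact_finite_nbhs cK hV; exists b => x; exact: hb.
Qed.

Lemma cts_bounded (f : K -> R) : continuous f -> exists M, forall x, `|f x| <= M.
Proof.
move=> cf; have cn : continuous (fun x => `|f x|).
  apply: (@cts_comp _ _ _ (fun r : R => `|r|)); [exact: norm_continuous|exact: cf].
have K0 : [set: K] !=set0 by exists one.
have [c _ h] := compact_EVT_max K0 cK (@continuous_subspaceT _ _ setT _ cn).
by exists `|f c| => x; apply: h; rewrite inE.
Qed.

(** The gain [d] is independent of [s]: averages of left translates of [f] inherit its modulus of
    uniform continuity under right perturbations. With the group covered by N translates of a small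
    [V], a further averaging moves every point near the minimum of the current average at least once
    in N. *)
Lemma osc_step (f : K -> R) e : continuous f -> 0 < e ->
  exists2 d, 0 < d & forall s m L, s <> [::] ->
    (forall x, m <= avg s (fun a => f (mul a x)) <= m + L) -> e <= L ->
    exists t m', t <> [::] /\
      forall x, m' <= avg t (fun a => f (mul a x)) <= m' + (L - d).
Proof.
move=> cf e0; have e20 : 0 < e / 2 by lra.
have [b hb] := finite_cover (unif_cts cf e20).
have b0 : b <> [::] by move=> b0; have [a] := hb one; rewrite b0.
have N0 : 0 < (size b)%:R :> R by case: (b) b0.
exists (e / 2 / (size b)%:R); first by rewrite divr_gt0.
move=> s m L s0 hs eL.
pose g x := avg s (fun a => f (mul a x)).
have cg : continuous g by rewrite /g /avg; cts.
have K0 : [set: K] !=set0 by exists one.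
have [x0 _ hx0] := compact_EVT_min K0 cK (@continuous_subspaceT _ _ setT _ cg).
have {}hx0 x : g x0 <= g x by apply: hx0; rewrite inE.
(* The new average is the mean over [b] of [g (x0 b^-1 x)], where [x0] minimizes [g]. One term is at
   most [g x0 + e / 2] and the others at most [g x0 + L]; since [e <= L], the mean drops by [e / 2]
   divided by the size of [b]. *)
exists (allpairs (fun a b => mul a (mul x0 (inv b))) s b), (g x0); split.
  exact: allpairs_neq0.
move=> x; rewrite avg_allpairs avg_swap.
have -> : avg b (fun b0 => avg s (fun a => f (mul (mul a (mul x0 (inv b0))) x)))
   = avg b (fun b0 => g (mul x0 (mul (inv b0) x))).
  by apply: eq_avg => c; apply: eq_avg => a; rewrite !mulA.
apply/andP; split.
  by rewrite -[leLHS](@avg_cst R K b)//; apply: avg_le => a; exact: hx0.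
have [c cb hc] := hb x.
have gc : g (mul x0 (mul (inv c) x)) <= g x0 + e / 2.
  rewrite -lerBlDl; apply: le_trans (ler_norm _) _.
  have -> : g (mul x0 (mul (inv c) x)) - g x0 =
     avg s (fun a => f (mul (mul a x0) (mul (inv c) x)) - f (mul a x0)) - 0.
    rewrite subr0 /avg sumrB mulrBl; congr (_ / _ - _).
    by apply: eq_bigr => a _; rewrite !mulA.
  apply: avg_near => // a; rewrite subr0; apply/ltW.
  exact: (hc (mul a x0)).
have gu y : g y <= m + L by have /andP[] := hs y.
have gl : m <= g x0 by have /andP[] := hs x0.
have bN : (size b)%:R = 1 + (size (rem c b))%:R :> R.
  by rewrite size_rem// nat1r prednK//; case: (b) b0.
rewrite {1}/avg (big_rem c)//= ler_pdivrMr//.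
have h : \sum_(y <- rem c b) g (mul x0 (mul (inv y) x)) <= (m + L) * (size (rem c b))%:R.
  apply: (le_trans (ler_sum _ (fun y _ => gu _))).
  by rewrite big_const_seq count_predT iter_addr_0 mulr_natr.
have -> : (g x0 + (L - e / 2 / (size b)%:R)) * (size b)%:R = (g x0 + L) * (size b)%:R - e / 2.
  by field; rewrite gt_eqF.
rewrite bN.
have := ler_wpM2r (ler0n R (size (rem c b))) (_ : m + L <= g x0 + L).
rewrite lerD2r => /(_ gl); nra.
Qed.

Lemma small_osc (f : K -> R) e : continuous f -> 0 < e ->
  exists s m, s <> [::] /\ forall x, m <= avg s (fun a => f (mul a x)) <= m + e.
Proof.
move=> cf e0; have [d d0 hd] := osc_step cf e0.
have [M hM] := cts_bounded cf.
have H k : (exists s m, s <> [::] /\ forall x, m <= avg s (fun a => f (mul a x)) <= m + e)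
   \/ (exists s m, s <> [::] /\
        forall x, m <= avg s (fun a => f (mul a x)) <= m + (2 * M - k%:R * d)).
  elim: k => [|k [H|[s [m [s0 hs]]]]]; [right|by left|].
    exists [:: one], (- M); split => // x; rewrite /avg big_seq1 divr1 mul1.
    by have := hM x; rewrite ler_norml; lra.
  have [h|h] := leP e (2 * M - k%:R * d); last first.
    by left; exists s, m; split => // x; have := hs x; lra.
  right; have [t [m' [t0 ht]]] := hd s m _ s0 hs h.
  exists t, m'; split => // x; have := ht x; rewrite -natr1; lra.
(* After more than [2 * M / d] steps the interval would have negative length, so the first
   alternative has occurred. *)
have [//|[s [m [_ /(_ one)]]]] := H (Num.bound (2 * M / d)).+1.
have M0 : 0 <= 2 * M / d.
  by rewrite divr_ge0 ?(ltW d0)// mulr_ge0//; apply: le_trans (hM one).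
have := archi_boundP M0; rewrite ltr_pdivrMr// -natr1; lra.
Qed.
End Osc.

(** * The invariant mean of a compact group *)

(** Exchanges left and right translates, so that [small_osc] serves for both. *)
Lemma opp_topological_group (K : topologicalType) (mul : K -> K -> K) inv one :
  is_topological_group mul inv one -> is_topological_group (fun x y => mul y x) inv one.
Proof.
case=> mA m1 mV cm ci; split => //.
- by move=> x; have [] := m1 x.
- by move=> x; have [] := mV x.
- cts.
Qed.

Lemma prod_topological_group (K : topologicalType) (mul : K -> K -> K) inv one :
  is_topological_group mul inv one ->
  is_topological_group (fun p q : K * K => (mul p.1 q.1, mul p.2 q.2))
    (fun p => (inv p.1, inv p.2)) (one, one).
Proof.
case=> mA m1 mV cm ci; split => //=.
- by move=> x y z; rewrite !mA.
- by case=> x y /=; have [-> ->] := m1 x; have [-> ->] := m1 y.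
- by case=> x y /=; have [-> ->] := mV x; have [-> ->] := mV y.
- cts.
- cts.
Qed.

Section Mean.
Variables (R : realType) (K : topologicalType).
Variables (mul : K -> K -> K) (inv : K -> K) (one : K).
Hypothesis Hg : is_topological_group mul inv one.
Hypothesis cK : compact [set: K].
Let mulA := tg_mulA Hg.
Let cmul : continuous (fun p : K * K => mul p.1 p.2) := tg_mul_cts Hg.
Let cinv : continuous inv := tg_inv_cts Hg.
Let invM := tg_invM Hg.
Let invK := tg_invK Hg.

Notation lmean := (@lmean R K mul).
Notation rmean := (@rmean R K mul).
Implicit Types f g : K -> R.

(** The double average of [f (mul a b)] is close to [d] when [b] is averaged first, and close to [c]
    when [a] is. *)
Lemma lrmean_approx f c d e : lmean f c -> rmean f d -> 0 < e -> `|c - d| <= e.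
Proof.
move=> hl hr e0; have e20 : 0 < e / 2 by lra.
have [s [s0 hs]] := hl _ e20; have [t [t0 ht]] := hr _ e20.
pose A := avg s (fun a => avg t (fun b => f (mul a b))).
have h1 : `|A - d| <= e / 2 by apply: avg_near => // a; exact: ht.
have h2 : `|A - c| <= e / 2.
  by rewrite /A avg_swap; apply: avg_near => // b; exact: hs.
move: h1 h2; rewrite !ler_distl; lra.
Qed.

Lemma lrmean_unique f c d : lmean f c -> rmean f d -> c = d.
Proof.
move=> hl hr; apply/eqP; rewrite -subr_eq0 -normr_eq0 eq_le normr_ge0 andbT.
by apply/ler_addgt0Pr => e e0; rewrite add0r; exact: (lrmean_approx hl hr).
Qed.

Lemma exists_mean f : continuous f -> exists c, lmean f c /\ rmean f c.
Proof.
move=> cf.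
have osl e : 0 < e -> exists s m, s <> [::] /\ forall x, m <= avg s (fun a => f (mul a x)) <= m + e.
  exact: (small_osc Hg cK cf).
have osr e : 0 < e -> exists s m, s <> [::] /\ forall x, m <= avg s (fun a => f (mul x a)) <= m + e.
  exact: (small_osc (opp_topological_group Hg) cK cf).
pose S : set R := [set M | exists s, s <> [::] /\ forall x, avg s (fun a => f (mul a x)) <= M].
(* Comparing the two orders of a double average shows that lower bounds of right averages lie below
   upper bounds of left averages. The infimum of the latter is therefore squeezed between averages
   of small oscillation on both sides. *)
have key t m' M : t <> [::] -> (forall x, m' <= avg t (fun a => f (mul x a))) -> S M -> m' <= M.
  move=> t0 ht [s [s0 hs]].
  rewrite -(@avg_cst R K s m')//.
  apply: (@le_trans _ _ (avg s (fun a => avg t (fun b => f (mul a b))))).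
    by apply: avg_le => a.
  by rewrite avg_swap -[leRHS](@avg_cst R K t M)//; apply: avg_le => b.
have Sn0 : S !=set0.
  have [s [m [s0 hs]]] := osl 1 ltr01.
  by exists (m + 1); exists s; split => // x; case/andP: (hs x).
have Slb t m' : t <> [::] -> (forall x, m' <= avg t (fun a => f (mul x a))) -> lbound S m'.
  by move=> t0 ht M; exact: key ht.
have hlb : has_lbound S.
  have [t [m' [t0 ht]]] := osr 1 ltr01.
  by exists m'; apply: (Slb t) => // x; case/andP: (ht x).
have near e : 0 < e -> exists s t m m', [/\ s <> [::], t <> [::],
   forall x, m <= avg s (fun a => f (mul a x)) <= m + e,
   forall x, m' <= avg t (fun a => f (mul x a)) <= m' + e &
   m' <= inf S <= m + e /\ m <= m' + e].
  move=> e0; have [s [m [s0 hs]]] := osl e e0; have [t [m' [t0 ht]]] := osr e e0.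
  exists s, t, m, m'; split => //; split.
    apply/andP; split.
      by apply: lb_le_inf => //; apply: (Slb t) => // x; case/andP: (ht x).
    by apply: ge_inf => //; exists s; split => // x; case/andP: (hs x).
  rewrite -(@avg_cst R K t m)//.
  apply: (@le_trans _ _ (avg t (fun b => avg s (fun a => f (mul a b))))).
    by apply: avg_le => b; case/andP: (hs b).
  rewrite avg_swap -[leRHS](@avg_cst R K s (m' + e))//; apply: avg_le => a.
  by case/andP: (ht a).
exists (inf S); split=> e e0.
- have [|s [t [m [m' [s0 t0 hs ht [h1 h2]]]]]] := near (e / 2); first by lra.
  exists s; split => // x; have := hs x; rewrite ler_distl; lra.
- have [|s [t [m [m' [s0 t0 hs ht [h1 h2]]]]]] := near (e / 2); first by lra.
  exists t; split => // x; have := ht x; rewrite ler_distl; lra.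
Qed.

(** The normalized Haar integral on continuous functions; 0 is the default when no two-sided mean
    exists. *)
Definition mean (f : K -> R) : R := xget 0 [set c | lmean f c /\ rmean f c].

Lemma meanP f : continuous f -> lmean f (mean f) /\ rmean f (mean f).
Proof.
move=> cf; have [c hc] := exists_mean cf.
by rewrite /mean; case: xgetP => [y _|/(_ c)].
Qed.

(** By [lrmean_unique], a mean can be identified from one side only; the proofs below use whichever
    side commutes with the operation at hand. *)
Lemma mean_lmean f c : continuous f -> lmean f c -> mean f = c.
Proof. by move=> cf h; have [_ r] := meanP cf; exact/esym/(lrmean_unique h r). Qed.

Lemma mean_rmean f c : continuous f -> rmean f c -> mean f = c.
Proof. by move=> cf h; have [l _] := meanP cf; exact: (lrmean_unique l h). Qed.

Lemma mean_rtrans f a : continuous f -> mean (fun x => f (mul x a)) = mean f.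
Proof.
move=> cf; apply: mean_lmean; first by cts.
move=> e e0; have [s [s0 hs]] := (meanP cf).1 e e0.
exists s; split => // x; have := hs (mul x a).
by under eq_avg do rewrite mulA.
Qed.

Lemma mean_ltrans f a : continuous f -> mean (fun x => f (mul a x)) = mean f.
Proof.
move=> cf; apply: mean_rmean; first by cts.
move=> e e0; have [s [s0 hs]] := (meanP cf).2 e e0.
exists s; split => // x; have := hs (mul a x).
by under eq_avg do rewrite -mulA.
Qed.

Lemma map_neq0 (S T : Type) (h : S -> T) s : s <> [::] -> map h s <> [::].
Proof. by case: s. Qed.

Lemma mean_inv f : continuous f -> mean (fun x => f (inv x)) = mean f.
Proof.
move=> cf; apply: mean_rmean; first by cts.
move=> e e0; have [s [s0 hs]] := (meanP cf).1 e e0.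
exists (map inv s); split; first exact: map_neq0.
move=> x; rewrite avg_map; have := hs (inv x).
by under eq_avg do rewrite -[X in mul X _]invK -invM.
Qed.

Lemma mean_cst c : mean (fun _ => c) = c.
Proof.
apply: mean_lmean; first by cts.
by move=> e e0; exists [:: one]; split => // x; rewrite avg_cst// subrr normr0 ltW.
Qed.

Lemma meanZ c f : continuous f -> mean (fun x => c * f x) = c * mean f.
Proof.
move=> cf; apply: mean_lmean; first by cts.
move=> e e0; have c1 : 0 < `|c| + 1 by rewrite ltr_wpDl.
have [s [s0 hs]] := (meanP cf).1 (e / (`|c| + 1)) (divr_gt0 e0 c1).
exists s; split => // x; rewrite avgZ -mulrBr normrM.
apply: le_trans (ler_wpM2l (normr_ge0 c) (hs x)) _.
rewrite mulrA ler_pdivrMr// mulrC ler_wpM2l ?(ltW e0)//; lra.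
Qed.

Lemma meanD f g : continuous f -> continuous g ->
  mean (fun x => f x + g x) = mean f + mean g.
Proof.
move=> cf cg; apply: mean_lmean; first by cts.
move=> e e0; have e20 : 0 < e / 2 by lra.
have [s [s0 hs]] := (meanP cf).1 _ e20.
(* A single list must serve both functions. Averaging [g] over [s] keeps its mean, so a list [t] for
   [h] combines with [s]: the products [a b] average [f] well through [a] and [g] well through
   [b]. *)
pose h x := avg s (fun a => g (mul a x)).
have ch : continuous h by rewrite /h /avg; cts.
have hh : rmean h (mean g).
  move=> d d0; have [t [t0 ht]] := (meanP cg).2 _ d0.
  exists t; split => // x; rewrite /h avg_swap; apply: avg_near => // a.
  by have := ht (mul a x); under eq_avg do rewrite -mulA.
have [t [t0 ht]] := (meanP ch).1 _ e20; rewrite (mean_rmean ch hh) in ht.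
exists (allpairs (fun a b => mul a b) s t); split; first exact: allpairs_neq0.
move=> x; rewrite avg_allpairs; under eq_avg do rewrite avgD; rewrite avgD.
rewrite opprD addrACA; apply: le_trans (ler_normD _ _) _.
rewrite [leRHS](splitr e); apply: lerD.
  rewrite avg_swap; apply: avg_near => // b.
  by have := hs (mul b x); under eq_avg do rewrite mulA.
rewrite avg_swap; have := ht x; rewrite /h.
by under eq_avg do under eq_avg do rewrite mulA.
Qed.

Lemma mean_ge0 f : continuous f -> (forall x, 0 <= f x) -> 0 <= mean f.
Proof.
move=> cf f0; apply/ler_addgt0Pr => e e0.
have [s [s0 hs]] := (meanP cf).1 _ e0; have := hs one; rewrite ler_distl => /andP[_].
apply: le_trans; rewrite -(@avg_cst R K s 0)//; exact: avg_le.
Qed.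

Lemma meanB f g : continuous f -> continuous g ->
  mean (fun x => f x - g x) = mean f - mean g.
Proof.
move=> cf cg; under eq_fun do rewrite -mulN1r.
by rewrite meanD ?meanZ ?mulN1r//; cts.
Qed.

Lemma mean_le f g : continuous f -> continuous g -> (forall x, f x <= g x) ->
  mean f <= mean g.
Proof.
move=> cf cg h; rewrite -subr_ge0 -meanB//; apply: mean_ge0; first by cts.
by move=> x; rewrite subr_ge0.
Qed.

Lemma mean_near f c e : continuous f -> (forall x, `|f x - c| <= e) -> `|mean f - c| <= e.
Proof.
move=> cf h; rewrite ler_distl; apply/andP; split.
- rewrite -(mean_cst (c - e)); apply: mean_le => [|//|x]; first by cts.
  by have := h x; rewrite ler_distl => /andP[].
- rewrite -(mean_cst (c + e)); apply: mean_le => [//||x]; first by cts.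
  by have := h x; rewrite ler_distl => /andP[].
Qed.

Lemma mean_sum (I : Type) (r : seq I) (f : I -> K -> R) : (forall i, continuous (f i)) ->
  mean (fun x => \sum_(i <- r) f i x) = \sum_(i <- r) mean (f i).
Proof.
move=> cf; elim: r => [|i r IH].
  by under eq_fun do rewrite big_nil; rewrite big_nil mean_cst.
by under eq_fun do rewrite big_cons; rewrite big_cons meanD ?IH//; apply: cts_sum.
Qed.

Lemma mean_avg (I : Type) (r : seq I) (f : I -> K -> R) : (forall i, continuous (f i)) ->
  mean (fun x => avg r (fun i => f i x)) = avg r (fun i => mean (f i)).
Proof.
move=> cf; rewrite /avg; under eq_fun do rewrite mulrC.
by rewrite meanZ ?mean_sum 1?mulrC//; exact: cts_sum.
Qed.

(** Finitely many translates of the region where [f] exceeds [f x0 / 2] cover [K], so an average of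
    translates, which has the same mean as [f], is bounded below by a positive constant. *)
Lemma mean_gt0 f x0 : continuous f -> (forall x, 0 <= f x) -> 0 < f x0 -> 0 < mean f.
Proof.
move=> cf f0 fx0; have d0 : 0 < f x0 / 2 by lra.
have [b hb] := finite_cover Hg cK (unif_cts Hg cK cf d0).
have b0 : b <> [::] by move=> b0; have [a] := hb one; rewrite b0.
have N0 : 0 < (size b)%:R :> R by case: (b) b0.
pose g x := avg b (fun a => f (mul x0 (mul (inv a) x))).
have cg : continuous g by rewrite /g /avg; cts.
have mg : mean g = mean f.
  rewrite /g mean_avg; last by move=> a; cts.
  rewrite -[RHS](@avg_cst R K b)//; apply: eq_avg => a.
  under eq_fun do rewrite mulA; exact: mean_ltrans.
rewrite -mg; apply: (@lt_le_trans _ _ (f x0 / 2 / (size b)%:R)); first exact: divr_gt0.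
rewrite -[leLHS]mean_cst; apply: mean_le => [|//|x]; first by cts.
rewrite ler_pM2r ?invr_gt0//; have [a ab ha] := hb x.
rewrite (big_rem a)//=; apply: ler_wpDr; first exact: sumr_ge0.
by have := ha x0; rewrite ltr_distl; lra.
Qed.

Lemma mean_param_cts (F : K * K -> R) : continuous F ->
  continuous (fun x => mean (fun y => F (x, y))).
Proof.
move=> cF x; apply/cvgrPdist_le => e e0.
have := @cts_near_diff R K K F x e cK cF e0; apply: filterS => x' h.
rewrite distrC -meanB; [|by cts|by cts].
rewrite -[X in `|X|]subr0; apply: mean_near; first by cts.
by move=> y; rewrite subr0; exact: ltW.
Qed.

(** Left invariance in each variable allows [F] to be replaced by its average over the translations
    in [s], which is uniformly close to [m]. *)
Lemma iterated_mean_near (F : K * K -> R) s m e : continuous F -> s <> [::] ->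
  (forall p, `|avg s (fun a => F (mul a.1 p.1, mul a.2 p.2)) - m| <= e) ->
  `|mean (fun x => mean (fun y => F (x, y))) - m| <= e.
Proof.
move=> cF s0 hs.
pose G x a := mean (fun y => F (mul a.1 x, mul a.2 y)).
have GE x a : G x a = mean (fun y => F (mul a.1 x, y)).
  by rewrite /G (@mean_ltrans (fun y => F (mul a.1 x, y)))//; cts.
have cG : continuous (fun x => mean (fun y => F (x, y))) by exact: mean_param_cts.
have cGa a : continuous (fun x => G x a).
  under eq_fun do rewrite GE.
  have ca : continuous (fun x => mul a.1 x) by cts.
  exact: (cts_comp cG ca).
have -> : mean (fun x => mean (fun y => F (x, y))) = mean (fun x => avg s (G x)).
  rewrite mean_avg// -[LHS](@avg_cst R _ s)//; apply: eq_avg => a.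
  have -> : G^~ a = (fun x => mean (fun y => F (mul a.1 x, y))).
    by apply/funext => x; exact: GE.
  by rewrite (@mean_ltrans (fun x => mean (fun y => F (x, y)))).
apply: mean_near; first by rewrite /avg; cts.
move=> x; rewrite /G -mean_avg; last by move=> a; cts.
apply: mean_near; first by rewrite /avg; cts.
by move=> y; exact: (hs (x, y)).
Qed.

(* Both iterated means are left invariant on [K * K], so each of them is close
   to the constant approximated by an average of left translates of [F]. *)
Lemma mean_fubini (F : K * K -> R) : continuous F ->
  mean (fun x => mean (fun y => F (x, y))) = mean (fun y => mean (fun x => F (x, y))).
Proof.
move=> cF; have cK2 : compact [set: K * K] by rewrite -setXTT; exact: compact_setX.
have cF2 : continuous (fun p : K * K => F (p.2, p.1)) by cts.
apply/eqP; rewrite -subr_eq0 -normr_eq0 eq_le normr_ge0 andbT.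
apply/ler_addgt0Pr => e e0; rewrite add0r; have e20 : 0 < e / 2 by lra.
have [s [m [s0 hs]]] := small_osc (prod_topological_group Hg) cK2 cF e20.
have hm p : `|avg s (fun a => F (mul a.1 p.1, mul a.2 p.2)) - m| <= e / 2.
  by have := hs p; rewrite ler_distl; lra.
have h1 := iterated_mean_near cF s0 hm.
(* The other order of integration is the same estimate for [F] with its variables exchanged, the
   translating pairs being exchanged too. *)
have h2 := @iterated_mean_near _ (map (fun p => (p.2, p.1)) s) m (e / 2) cF2 (map_neq0 s0).
have {h2} := h2 _; move: h1; rewrite /= !ler_distl => h1 h2.
suff : forall p : K * K, `|avg [seq (p.2, p.1) | p <- s]
   (fun a => F (mul a.2 p.2, mul a.1 p.1)) - m| <= e / 2 by move=> /h2; lra.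
by move=> p; rewrite avg_map; exact: (hm (p.2, p.1)).
Qed.
End Mean.

(** * Convolution *)

Lemma uniform_cauchy_limit (R : realType) (X : topologicalType) (W : nat -> X -> R) :
  (forall n, continuous (W n)) ->
  (forall e, 0 < e -> exists N, forall n m, (N <= n)%N -> (N <= m)%N ->
     forall x, `|W n x - W m x| <= e) ->
  exists2 p, continuous p & forall e, 0 < e ->
    exists N, forall n, (N <= n)%N -> forall x, `|W n x - p x| <= e.
Proof.
move=> cW hW.
have cv x : cvgn (W ^~ x).
  apply: cauchy_cvg; apply: cauchy_exP => e e0.
  have [|N hN] := hW (e / 2); first by lra.
  exists (W N x); exists N => // n /= Nn; have := hN N n (leqnn N) Nn x.
  rewrite /ball /=; lra.
pose p x := limn (W ^~ x).
have up e : 0 < e -> exists N, forall n, (N <= n)%N -> forall x, `|W n x - p x| <= e.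
  move=> e0; have [N hN] := hW e e0; exists N => n Nn x.
  have cd : (fun m => `|W n x - W m x|) @ \oo --> `|W n x - p x|.
    by apply: cvg_norm; apply: cvgB; [exact: cvg_cst|exact: cv].
  apply: (@closed_cvg _ _ _ eventually_filter (fun m => `|W n x - W m x|)
    (fun r => r <= e) _ _ _ cd).
    exact: closed_le.
  by exists N => // m /= Nm; exact: hN.
exists p => // x; apply/cvgrPdist_le => e e0.
have [|N hN] := up (e / 4); first by lra.
have := cW N x => /cvgrPdist_le /(_ (e / 4)).
have e40 : 0 < e / 4 by lra.
move=> /(_ e40); apply: filterS => y.
have := hN N (leqnn N) x; have := hN N (leqnn N) y.
rewrite !ler_distl; lra.
Qed.

Section Convolution.
Variables (R : realType) (K : topologicalType).
Variables (mul : K -> K -> K) (inv : K -> K) (one : K).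
Hypothesis Hg : is_topological_group mul inv one.
Hypothesis cK : compact [set: K].
Let mulA := tg_mulA Hg.
Let mul1 := tg_mul1g Hg.
Let cmul : continuous (fun p : K * K => mul p.1 p.2) := tg_mul_cts Hg.
Let cinv : continuous inv := tg_inv_cts Hg.
Let mulK := tg_mulgK Hg.
Let mulVK := tg_mulgVK Hg.
Let invM := tg_invM Hg.
Let invK := tg_invK Hg.

Implicit Types f g h : K -> R.
Notation I := (@mean R K mul).

Definition convol f g x : R := I (fun y => f (mul x (inv y)) * g y).
Definition flip f x : R := f (inv x).
Definition dot f g : R := I (fun x => f x * g x).

Lemma convol_cts f g : continuous f -> continuous g -> continuous (convol f g).
Proof.
move=> cf cg.
apply: (@mean_param_cts R K mul inv one Hg cK
  (fun p => f (mul p.1 (inv p.2)) * g p.2)).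
cts.
Qed.

Lemma flip_cts f : continuous f -> continuous (flip f).
Proof. by move=> cf; rewrite /flip; cts. Qed.

Lemma mean_flip f x : continuous f -> I (fun y => f (mul x (inv y))) = I f.
Proof.
move=> cf; rewrite (@mean_inv _ _ _ _ _ Hg cK (fun y => f (mul x y))); last by cts.
exact: (mean_ltrans Hg cK).
Qed.

(** The substitution of [z y^-1] for [z] in the inner mean, followed by Fubini. *)
Lemma convolA f g h : continuous f -> continuous g -> continuous h ->
  convol (convol f g) h = convol f (convol g h).
Proof.
move=> cf cg ch; apply/funext => x; rewrite /convol.
transitivity (I (fun y => I (fun z => f (mul x (inv z)) * g (mul z (inv y)) * h y))).
  congr I; apply/funext => y.
  rewrite mulrC -(meanZ Hg cK); last by cts.
  rewrite -(@mean_rtrans _ _ _ _ _ Hg cK _ (inv y)); last by cts.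
  by congr I; apply/funext => z; rewrite invM invK mulA mulVK mulrC.
rewrite -(mean_fubini Hg cK (F := fun p => f (mul x (inv p.1)) * g (mul p.1 (inv p.2)) * h p.2));
  last by cts.
congr I; apply/funext => y; rewrite -(meanZ Hg cK); last by cts.
by congr I; apply/funext => z; rewrite mulrA.
Qed.

Lemma convol_rtrans f g a : continuous f -> continuous g ->
  convol f (fun x => g (mul x a)) = (fun x => convol f g (mul x a)).
Proof.
move=> cf cg; apply/funext => x; rewrite /convol.
rewrite -[RHS](@mean_rtrans _ _ _ _ _ Hg cK _ a); last by cts.
by congr I; apply/funext => y; rewrite invM mulA mulK.
Qed.

Lemma convol_ltrans f g a : convol (fun x => f (mul a x)) g = (fun x => convol f g (mul a x)).
Proof. by apply/funext => x; congr I; apply/funext => y; rewrite mulA. Qed.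

Lemma convolDr f g h : continuous f -> continuous g -> continuous h ->
  convol f (fun x => g x + h x) = (fun x => convol f g x + convol f h x).
Proof.
move=> cf cg ch; apply/funext => x; rewrite /convol -(meanD Hg cK); [|cts..].
by under eq_fun do rewrite mulrDr.
Qed.

Lemma convolZr c f g : continuous f -> continuous g ->
  convol f (fun x => c * g x) = (fun x => c * convol f g x).
Proof.
move=> cf cg; apply/funext => x; rewrite /convol -(meanZ Hg cK); last by cts.
by under eq_fun do rewrite mulrCA.
Qed.

Lemma convolBl f g h : continuous f -> continuous g -> continuous h ->
  convol (fun x => f x - g x) h = (fun x => convol f h x - convol g h x).
Proof.
move=> cf cg ch; apply/funext => x; rewrite /convol -(meanB Hg cK); [|cts..].
by under eq_fun do rewrite mulrBl.
Qed.

Lemma convol_sumr (J : Type) (r : seq J) f (g : J -> K -> R) :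
  continuous f -> (forall i, continuous (g i)) ->
  convol f (fun x => \sum_(i <- r) g i x) = (fun x => \sum_(i <- r) convol f (g i) x).
Proof.
move=> cf cg; apply/funext => x; rewrite /convol.
under eq_fun do rewrite mulr_sumr.
rewrite (mean_sum Hg cK)// => i; have := cg i => ?; cts.
Qed.

Lemma flip_convol f g : continuous f -> continuous g ->
  flip (convol f g) = convol (flip g) (flip f).
Proof.
move=> cf cg; apply/funext => x; rewrite /convol /flip.
rewrite -[RHS](@mean_rtrans _ _ _ _ _ Hg cK _ x); last by cts.
by congr I; apply/funext => y; rewrite !invM !invK mulK mulrC.
Qed.

Lemma flipK f : flip (flip f) = f.
Proof. by apply/funext => x; rewrite /flip invK. Qed.

(** Turns inner products of convolution powers into values at [one] of a single power. *)
Lemma dotE f g : dot f g = convol (flip f) g one.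
Proof. by congr I; apply/funext => x; rewrite mul1 /flip invK. Qed.

Lemma dotC f g : dot f g = dot g f.
Proof. by congr I; apply/funext => x; rewrite mulrC. Qed.

Lemma dotZl c f g : continuous f -> continuous g -> dot (fun x => c * f x) g = c * dot f g.
Proof.
move=> cf cg; rewrite /dot -(meanZ Hg cK); last by cts.
by under eq_fun do rewrite -mulrA.
Qed.

Lemma dotBl f g h : continuous f -> continuous g -> continuous h ->
  dot (fun x => f x - g x) h = dot f h - dot g h.
Proof.
move=> cf cg ch; rewrite /dot -(meanB Hg cK); [|cts..].
by under eq_fun do rewrite mulrBl.
Qed.

Lemma dot_suml (J : Type) (r : seq J) (g : J -> K -> R) h :
  (forall i, continuous (g i)) -> continuous h ->
  dot (fun x => \sum_(i <- r) g i x) h = \sum_(i <- r) dot (g i) h.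
Proof.
move=> cg ch; rewrite /dot; under eq_fun do rewrite mulr_suml.
rewrite (mean_sum Hg cK)// => i; have := cg i => ?; cts.
Qed.

Lemma dot_ge0 f : continuous f -> 0 <= dot f f.
Proof. by move=> cf; apply: (mean_ge0 Hg cK) => [|x]; [cts|rewrite -expr2 sqr_ge0]. Qed.

Lemma dot_gt0 f x : continuous f -> f x != 0 -> 0 < dot f f.
Proof.
move=> cf fx; apply: (mean_gt0 Hg cK (x0 := x)) => [|y|]; first by cts.
- by rewrite -expr2 sqr_ge0.
- by rewrite -expr2 exprn_even_gt0.
Qed.

Lemma dot_CS f g : continuous f -> continuous g -> dot f g ^+ 2 <= dot f f * dot g g.
Proof.
move=> cf cg.
have quad t : 0 <= dot f f - 2 * t * dot f g + t ^+ 2 * dot g g.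
  have c1 : continuous (fun x => t * g x) by cts.
  have c2 : continuous (fun x => f x - t * g x) by cts.
  have := dot_ge0 c2; rewrite dotBl// [dot f _]dotC [dot (fun x => t * g x) _]dotC.
  rewrite !dotBl// [dot f (fun x => t * g x)]dotC !dotZl// [dot g (fun x => t * g x)]dotC dotZl//.
  rewrite [dot g f]dotC; congr (_ <= _); ring.
have [g0|g0] := eqVneq (dot g g) 0.
  have [h0|h0] := eqVneq (dot f g) 0; first by rewrite h0 g0 expr0n mulr0.
  (* When [dot g g = 0] the quadratic is affine in [t], and this [t] gives it the value -1. *)
  have := quad ((dot f f + 1) / (2 * dot f g)); rewrite g0.
  rewrite mulr0 addr0.
  have -> : 2 * ((dot f f + 1) / (2 * dot f g)) * dot f g = dot f f + 1 by field.
  lra.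
have gp : 0 < dot g g by rewrite lt_def g0 dot_ge0.
(* The minimizer of the quadratic. *)
have := quad (dot f g / dot g g).
have -> : dot f f - 2 * (dot f g / dot g g) * dot f g + (dot f g / dot g g) ^+ 2 * dot g g
  = (dot f f * dot g g - dot f g ^+ 2) / dot g g by field.
by rewrite pmulr_lge0 ?invr_gt0// subr_ge0.
Qed.

(** Cauchy-Schwarz applied to [y -> f (x y^-1)], which has the same norm as [f]. This is what
    converts norm estimates into uniform ones. *)
Lemma convol_sq_le f g x : continuous f -> continuous g ->
  convol f g x ^+ 2 <= dot f f * dot g g.
Proof.
move=> cf cg; have c : continuous (fun y => f (mul x (inv y))) by cts.
apply: le_trans (dot_CS c cg) _; rewrite {1}/dot.
by rewrite (@mean_flip (fun y => f y * f y))//; cts.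
Qed.
End Convolution.

(** * An eigenfunction of convolution *)

Lemma ler_normX2 (R : realType) (x e : R) : 0 <= e -> x ^+ 2 <= e ^+ 2 -> `|x| <= e.
Proof. by move=> e0 h; rewrite -(@ler_pXn2r _ 2) ?nnegrE ?normr_ge0// real_normK// num_real. Qed.

Section Eigen.
Variables (R : realType) (K : topologicalType).
Variables (mul : K -> K -> K) (inv : K -> K) (one : K).
Hypothesis Hg : is_topological_group mul inv one.
Hypothesis cK : compact [set: K].
Notation convol := (@convol R K mul inv).
Notation flip := (@flip R K inv).
Notation dot := (@dot R K mul).

Variable chi : K -> R.
Hypothesis chi_cts : continuous chi.
Hypothesis chi_flip : flip chi = chi.
Variable x0 : K.
Hypothesis chi_neq0 : chi x0 != 0.

(** The convolution power of [chi] with exponent n + 1; the shift explains the successors in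
    [w_conv] and [dot_w]. *)
Let w n := iter n (convol chi) chi.

Let w_cts n : continuous (w n).
Proof. by elim: n => [|n IH] //=; exact: (convol_cts Hg cK). Qed.

Let w_conv n m : convol (w n) (w m) = w (n + m).+1.
Proof.
elim: n => [|n IH] //.
by rewrite [w n.+1]/= (convolA Hg cK) ?IH//; exact: w_cts.
Qed.

Let w_flip n : flip (w n) = w n.
Proof.
elim: n => [|n IH] //; rewrite [in LHS]/= (flip_convol Hg cK)//.
by rewrite IH chi_flip; have := w_conv n 0; rewrite addn0.
Qed.

Let dot_w n m : dot (w n) (w m) = w (n + m).+1 one.
Proof. by rewrite (dotE Hg) w_flip w_conv. Qed.

Let c n := dot (w n) (w n).
(** The power with exponent 2n + 2, that is [w n] convolved with itself. *)
Let P n := w (n + n).+1.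

Let P_conv n m : convol (P n) (P m) = P (n + m).+1.
Proof. by rewrite w_conv; congr w; lia. Qed.

Let dot_P n m : dot (P n) (P m) = c (n + m).+1.
Proof. by rewrite /c !dot_w; congr w; lia. Qed.

Let P_one n : P n one = c n. Proof. by rewrite /c dot_w. Qed.

(** As the square of the symmetric function [w n], [P n] attains its supremum norm at [one]. *)
Let P_le n x : `|P n x| <= c n.
Proof.
rewrite /P -w_conv; apply: ler_normX2; first exact: (dot_ge0 Hg cK).
by rewrite [leRHS]expr2; apply: (convol_sq_le Hg cK).
Qed.

(** The left side is the inner product of [P n] and [P m], bounded by the product of their supremum
    norms because the mean of 1 is 1. *)
Let c_submul n m : c (n + m).+1 <= c n * c m.
Proof.
have cPn := @w_cts (n + n).+1; have cPm := @w_cts (m + m).+1.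
rewrite -dot_P -[leRHS](mean_cst Hg cK).
apply: (mean_le Hg cK) => [||x]; [by cts|by cts|].
apply: le_trans (ler_norm _) _; rewrite normrM.
by apply: ler_pM; rewrite ?normr_ge0 ?P_le.
Qed.

Let c_logconvex n : c n.+1 ^+ 2 <= c n * c n.+2.
Proof.
have -> : c n.+1 = dot (w n) (w n.+2) by rewrite /c !dot_w; congr w; lia.
exact: (dot_CS Hg cK).
Qed.

Let c_gt0 n : 0 < c n.
Proof.
have c0 : 0 < c 0 by exact: (dot_gt0 Hg cK chi_cts chi_neq0).
(* Two consecutive terms are carried along, since log-convexity bounds [c n.+2] below by means of
   both. *)
suff : 0 < c n /\ 0 < c n.+1 by case.
elim: n => [|n [h1 h2]]; split => //.
  apply: (dot_gt0 Hg cK (x := one)); first exact: w_cts.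
  by rewrite -(dot_w 0 0) gt_eqF.
by have := c_logconvex n; rewrite -(pmulr_rgt0 _ h1); apply: lt_le_trans; rewrite exprn_gt0.
Qed.

Let r n := c n.+1 / c n.

Let r_nd : nondecreasing_seq r.
Proof.
apply/nondecreasing_seqP => n; rewrite /r ler_pdivrMr// mulrAC ler_pdivlMr//.
by have := c_logconvex n; rewrite mulrC expr2.
Qed.

Let r_ub : ubound (range r) (c 0).
Proof. by move=> _ [n _ <-]; rewrite /r ler_pdivrMr// mulrC; have := c_submul n 0; rewrite addn0. Qed.

Let lam := sup (range r).

Let r_cvg : r @ \oo --> lam.
Proof. by apply: nondecreasing_cvgn => //; exists (c 0); exact: r_ub. Qed.

Let r_le n : r n <= lam.
Proof. by apply: ub_le_sup; [exists (c 0); exact: r_ub|exists n]. Qed.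

Let lam_gt0 : 0 < lam.
Proof. by apply: lt_le_trans (r_le 0); exact: divr_gt0. Qed.

(** [c (n + k)] is [c n] times k successive ratios, each at least [r n] by monotonicity. *)
Let c_geo n k : c n * r n ^+ k <= c (n + k).
Proof.
elim: k => [|k IH]; first by rewrite expr0 mulr1 addn0.
rewrite exprSr mulrA addnS; apply: (@le_trans _ _ (c (n + k) * r (n + k))).
  apply: ler_pM => //.
  - by rewrite mulr_ge0 ?exprn_ge0 ?ltW// divr_gt0.
  - by rewrite ltW// divr_gt0.
  - by apply: r_nd; rewrite leq_addr.
by rewrite /r mulrC divfK// gt_eqF.
Qed.

(** Geometric growth and submultiplicativity give [c n * r n ^+ m.+1 <= c n * c m]; divide by [c n]
    and let n tend to infinity. *)
Let lam_le m : lam ^+ m.+1 <= c m.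
Proof.
have h : (fun n => r n ^+ m.+1) @ \oo --> lam ^+ m.+1.
  by apply: (cvg_comp _ (fun t : R => t ^+ m.+1) r_cvg); exact: exprn_continuous.
apply: (@closed_cvg _ _ _ eventually_filter (fun n => r n ^+ m.+1) (fun t => t <= c m) _ _ _ h).
  exact: closed_le.
near=> n; rewrite -(ler_pM2l (c_gt0 n)); apply: le_trans (c_geo _ _) _.
by rewrite addnS; exact: c_submul.
Unshelve. all: by end_near.
Qed.

Let e n := c n / lam ^+ n.+1.

Let e_ge1 n : 1 <= e n.
Proof. by rewrite /e ler_pdivlMr ?exprn_gt0// mul1r. Qed.

Let e_ni : nonincreasing_seq e.
Proof.
apply/nonincreasing_seqP => n; rewrite /e ler_pdivrMr ?exprn_gt0// [_ ^+ n.+2]exprSr mulrA.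
rewrite divfK ?expf_eq0 ?gt_eqF//= mulrC -ler_pdivrMr//; exact: r_le.
Qed.

(** With the indices of [dot_W], the bounded expression is the squared norm of [W n - W m]. *)
Let e_cauchy d : 0 < d -> exists N, forall n m k, (N <= n)%N -> (N <= m)%N -> (N <= k)%N ->
  e n + e m - 2 * e k <= d.
Proof.
move=> d0; have cv : e @ \oo --> inf (range e).
  by apply: nonincreasing_cvgn => //; exists 1 => _ [n _ <-].
have d40 : 0 < d / 4 by lra.
move/cvgrPdist_le: cv => /(_ _ d40) [N _ hN]; exists N => n m k hn hm hk.
have := hN _ hn; have := hN _ hm; have := hN _ hk.
rewrite /= !ler_distl; lra.
Qed.

Let W n x := (lam ^+ n.+1)^-1 * P n x.

Let W_cts n : continuous (W n).
Proof. by have cP := @w_cts (n + n).+1; rewrite /W /P; cts. Qed.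

Let dot_W n m : dot (W n) (W m) = e (n + m).+1.
Proof.
have cPn := @w_cts (n + n).+1.
rewrite {1}/W (dotZl Hg cK)//.
rewrite (dotC mul) {1}/W (dotZl Hg cK)//; last exact: w_cts.
rewrite dot_P /e [(m + n)%N]addnC.
have -> : lam ^+ (n + m).+2 = lam ^+ n.+1 * lam ^+ m.+1 by rewrite -exprD; congr (_ ^+ _); lia.
by field; rewrite !expf_neq0// gt_eqF.
Qed.

Let conv_W n : convol (P 0) (W n) = (fun x => lam * W n.+1 x).
Proof.
rewrite /W (convolZr Hg cK) ?P_conv; [|exact: w_cts..].
apply/funext => x; rewrite add0n mulrA; congr (_ * _).
by rewrite [lam ^+ n.+2]exprS; field; rewrite !expf_neq0// gt_eqF.
Qed.

(** Convolution by [P 0] maps [W n] to [lam * W n.+1], and [convol_sq_le] makes the image uniformly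
    small when [W n - W m] is small in norm. *)
Let W_diff n m x : (W n.+1 x - W m.+1 x) ^+ 2 <=
  lam ^- 2 * c 1 * (e (n + n).+1 + e (m + m).+1 - 2 * e (n + m).+1).
Proof.
have cd : continuous (fun x => W n x - W m x).
  by have := @W_cts n; have := @W_cts m => ? ?; cts.
have -> : W n.+1 x - W m.+1 x = lam^-1 * convol (P 0) (fun x => W n x - W m x) x.
  have cN : continuous (fun x => -1 * W m x) by have := @W_cts m => ?; cts.
  under [X in convol _ X]eq_fun do rewrite -mulN1r.
  rewrite (@convolDr _ _ _ _ _ Hg cK (P 0) (W n) (fun x => -1 * W m x))//; last exact: w_cts.
  rewrite (@convolZr _ _ _ _ _ Hg cK (-1) (P 0) (W m))//; last exact: w_cts.
  by rewrite !conv_W; field; rewrite gt_eqF.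
rewrite exprMn exprVn -[leRHS]mulrA; apply: ler_wpM2l.
  by rewrite invr_ge0 exprn_ge0// ltW.
have cP : continuous (P 0) by exact: w_cts.
apply: le_trans (convol_sq_le Hg cK _ cP cd) _.
rewrite dot_P addn0; apply: ler_wpM2l; first exact/ltW/c_gt0.
rewrite (dotBl Hg cK)//.
rewrite !(dotC mul _ (fun x => W n x - W m x)) !(dotBl Hg cK)//.
rewrite !dot_W [(m + n)%N]addnC; lra.
Qed.

(* The limit of [chi^(2n+2) / lam^(n+1)]: the numbers [c n], which are both
   [|chi^(n+1)|^2] and the values at [one] of [chi^(2n+2)], are log-convex and
   submultiplicative, hence [c n / lam^(n+1)] decreases and stays above 1. *)
Lemma exists_eigenfunction : exists l p, [/\ 0 < l, continuous p, p one != 0 &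
  convol (convol chi chi) p = (fun x => l * p x)].
Proof.
(* The sequence starts at [W 1] because [W_diff] controls successors only. *)
have [||p cp hp] := @uniform_cauchy_limit R K (fun n => W n.+1).
- by move=> n; exact: W_cts.
- move=> d d0.
  have D0 : 0 < lam ^- 2 * c 1 by rewrite mulr_gt0 ?invr_gt0 ?exprn_gt0.
  have [|N hN] := @e_cauchy (d ^+ 2 / (lam ^- 2 * c 1)).
    by rewrite divr_gt0 ?exprn_gt0.
  exists N => n m Nn Nm x; apply: ler_normX2; first exact: ltW.
  apply: le_trans (W_diff n m x) _; rewrite mulrC -ler_pdivlMr//.
  apply: hN; lia.
exists lam, p; split => //.
(* The value of [W N.+1] at [one] is [e N.+1], at least 1, so a tolerance of 1/2 keeps [p one]
   positive. *)
- rewrite gt_eqF//; have [//|N hN] := hp (1 / 2).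
  have := hN N (leqnn N) one; have : W N.+1 one = e N.+1 by rewrite /W P_one mulrC.
  by move=> ->; have := e_ge1 N.+1; rewrite ler_distl; lra.
- apply/funext => x; apply/eqP; rewrite -subr_eq0 -normr_eq0 eq_le normr_ge0 andbT.
  apply/ler_addgt0Pr => d d0; rewrite add0r.
  have cl : 0 < c 0 + lam by rewrite addr_gt0.
  have [|N hN] := hp (d / (c 0 + lam)); first by rewrite divr_gt0.
  have cW := @W_cts N.+1.
  have cP : continuous (P 0) by exact: w_cts.
  (* The supremum of [P 0] is at most [c 0]. Errors [c 0] and [lam] times the tolerance add up to
     [d], whence the denominator [c 0 + lam]. *)
  have h1 : `|convol (P 0) p x - lam * W N.+2 x| <= c 0 * (d / (c 0 + lam)).
    have -> : lam * W N.+2 x = convol (P 0) (W N.+1) x by rewrite conv_W.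
    have ci : continuous inv by case: Hg.
    have cm : continuous (fun p : K * K => mul p.1 p.2) by case: Hg.
    rewrite /convol -(meanB Hg cK); [|by cts|by cts].
    rewrite -[X in `|X|]subr0; apply: (mean_near Hg cK) => [|y]; first by cts.
    rewrite subr0 -mulrBr normrM; apply: ler_pM => //; rewrite distrC; exact: hN.
  have h2 : `|W N.+2 x - p x| <= d / (c 0 + lam) by exact: hN.
  have -> : convol (convol chi chi) p x - lam * p x =
    (convol (P 0) p x - lam * W N.+2 x) + lam * (W N.+2 x - p x) by rewrite /P/=; ring.
  apply: le_trans (ler_normD _ _) _; rewrite normrM (gtr0_norm lam_gt0).
  have -> : d = c 0 * (d / (c 0 + lam)) + lam * (d / (c 0 + lam)).
    by field; rewrite gt_eqF.
  by apply: lerD => //; rewrite ler_wpM2l// ltW.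
Qed.
End Eigen.

(** * Kernels of finite rank *)

Section Tensor.
Variables (F : fieldType) (X Y : Type).
Implicit Types (A : set (X -> F)) (B : set (Y -> F)) (k : X -> Y -> F).

(** The inductive form lets proofs peel off one elementary tensor at a time. With [setT] twice, it
    says that the kernel has finite rank. *)
Inductive tensor A B : (X -> Y -> F) -> Prop :=
| tensor0 k : (forall x y, k x y = 0) -> tensor A B k
| tensorS a b k k' : A a -> B b -> tensor A B k ->
    (forall x y, k' x y = a x * b y + k x y) -> tensor A B k'.

Lemma eq_tensor A B k k' : tensor A B k -> (forall x y, k' x y = k x y) -> tensor A B k'.
Proof. by move=> + e; have -> : k' = k by apply/funext => x; apply/funext => y. Qed.

Lemma tensor1 A B a b : A a -> B b -> tensor A B (fun x y => a x * b y).
Proof.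
move=> Aa Bb; apply: (tensorS (k := fun _ _ => 0) Aa Bb); first exact: tensor0.
by move=> x y; rewrite addr0.
Qed.

Lemma tensorD A B k k' : tensor A B k -> tensor A B k' -> tensor A B (fun x y => k x y + k' x y).
Proof.
elim=> [{}k k0|a b k1 {}k Aa Bb _ IH e] h.
  by apply: eq_tensor h _ => x y; rewrite k0 add0r.
by apply: tensorS Aa Bb (IH h) _ => x y; rewrite e addrA.
Qed.

Lemma tensor_bigsum A B n (k : 'I_n -> X -> Y -> F) :
  (forall i, tensor A B (k i)) -> tensor A B (fun x y => \sum_(i < n) k i x y).
Proof.
elim: n k => [|n IH] k h; first by apply: tensor0 => x y; rewrite big_ord0.
apply: eq_tensor (tensorD (h ord0) (IH _ (fun i => h (lift ord0 i)))) _ => x y.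
by rewrite big_ord_recl.
Qed.

Lemma tensor_sum A B n (a : 'I_n -> X -> F) (b : 'I_n -> Y -> F) :
  (forall i, A (a i) /\ B (b i)) -> tensor A B (fun x y => \sum_(i < n) a i x * b i y).
Proof.
by move=> h; apply: tensor_bigsum => i; have [Aa Bb] := h i; exact: tensor1.
Qed.

Lemma tensor_ordP A B k : tensor A B k -> exists n (a : 'I_n -> X -> F) (b : 'I_n -> Y -> F),
  (forall i, A (a i) /\ B (b i)) /\ forall x y, k x y = \sum_(i < n) a i x * b i y.
Proof.
elim=> [{}k k0|a b k1 {}k Aa Bb _ [n [u [v [h e1]]]] e].
  exists 0%N, (fun _ _ => 0), (fun _ _ => 0); split; first by case.
  by move=> x y; rewrite big_ord0.
exists n.+1, (fun i => if unlift ord0 i is Some j then u j else a),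
  (fun i => if unlift ord0 i is Some j then v j else b); split.
  by move=> i; case: unliftP.
move=> x y; rewrite big_ord_recl unlift_none e e1; congr (_ + _).
by apply: eq_bigr => i _; rewrite liftK.
Qed.

Lemma tensor_scale k (c : X -> F) (d : Y -> F) : tensor setT setT k ->
  tensor setT setT (fun x y => c x * d y * k x y).
Proof.
elim=> [{}k k0|a b k1 {}k _ _ _ IH e].
  by apply: tensor0 => x y; rewrite k0 mulr0.
apply: (@tensorS _ _ (fun x => c x * a x) (fun y => d y * b y)) IH _ => // x y.
by rewrite e mulrDr mulrACA.
Qed.

Lemma tensorM k k' : tensor setT setT k -> tensor setT setT k' ->
  tensor setT setT (fun x y => k x y * k' x y).
Proof.
move=> h h'; elim: h => [{}k k0|a b k1 {}k _ _ _ IH e].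
  by apply: tensor0 => x y; rewrite k0 mul0r.
by apply: eq_tensor (tensorD (tensor_scale a b h') IH) _ => x y; rewrite e mulrDl.
Qed.

(** The sets [P a] may overlap: the indicator of the first splits off one piece, and the induction
    treats the kernel restricted to its complement. *)
Lemma tensor_coverl (T : eqType) (s : seq T) (P : T -> set X) k :
  (forall x, (exists2 a, a \in s & P a x) \/ forall y, k x y = 0) ->
  (forall a, a \in s -> tensor setT setT (fun x y => (x \in P a)%:R * k x y)) ->
  tensor setT setT k.
Proof.
elim: s k => [|a s IH] k h0 h.
  by apply: tensor0 => x y; case: (h0 x) => [[b]|]; rewrite ?in_nil.
have h2 : tensor setT setT (fun x y => (x \notin P a)%:R * k x y).
  apply: IH => [x|b bs].
    have [xa|xa] := boolP (x \in P a); first by right=> y; rewrite mul0r.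
    case: (h0 x) => [[b]|k0]; last by right => y; rewrite k0 mulr0.
    rewrite inE => /orP[/eqP ->|bs Pb]; last by left; exists b.
    by move/mem_set; rewrite (negbTE xa).
  have bas : b \in a :: s by rewrite inE bs orbT.
  apply: eq_tensor (tensor_scale (fun x => (x \notin P a)%:R) (fun=> 1) (h b bas)) _.
  by move=> x y; rewrite mulr1 mulrCA.
apply: eq_tensor (tensorD (h a (mem_head a s)) h2) _ => x y.
by case: (x \in P a); rewrite ?mul1r ?mul0r ?addr0 ?add0r.
Qed.
End Tensor.

Lemma tensor_swap (F : fieldType) (X Y : Type) (k : X -> Y -> F) A B : tensor A B k ->
  tensor B A (fun y x => k x y).
Proof.
elim=> [{}k k0|a b k1 {}k Aa Bb _ IH e]; first by apply: tensor0 => y x.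
by apply: tensorS Bb Aa IH _ => y x; rewrite e mulrC.
Qed.

Lemma tensor_coverr (F : fieldType) (X Y : Type) (T : eqType) (s : seq T)
    (P : T -> set Y) (k : X -> Y -> F) :
  (forall y, (exists2 a, a \in s & P a y) \/ forall x, k x y = 0) ->
  (forall a, a \in s -> tensor setT setT (fun x y => (y \in P a)%:R * k x y)) ->
  tensor setT setT k.
Proof.
move=> h0 h; apply: (tensor_swap (k := fun y x => k x y)); apply: tensor_coverl h0 _ => a sa.
exact: (tensor_swap (h a sa)).
Qed.

Lemma tensor_comp (F : fieldType) (X Y X' Y' : Type) (f : X' -> X) (g : Y' -> Y) (k : X -> Y -> F) :
  tensor setT setT k -> tensor setT setT (fun x y => k (f x) (g y)).
Proof.
elim=> [{}k k0|a b k1 {}k _ _ _ IH e]; first by apply: tensor0 => y x.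
by apply: (@tensorS _ _ _ _ _ (fun x => a (f x)) (fun y => b (g y))) IH _.
Qed.

Lemma tensor_rmorph (F F' : fieldType) (X Y : Type) (phi : {rmorphism F -> F'}) (k : X -> Y -> F) :
  tensor setT setT k -> tensor setT setT (fun x y => phi (k x y)).
Proof.
elim=> [{}k k0|a b k1 {}k _ _ _ IH e]; first by apply: tensor0 => y x; rewrite k0 rmorph0.
apply: (@tensorS _ _ _ _ _ (fun x => phi (a x)) (fun y => phi (b y))) IH _ => // x y.
by rewrite e rmorphD rmorphM.
Qed.

Definition lin_set (F : fieldType) (X : Type) (A : set (X -> F)) : Prop :=
  A (fun _ => 0) /\ forall c f g, A f -> A g -> A (fun x => c * f x + g x).

Section LinSet.
Variables (F : fieldType) (X : Type) (A : set (X -> F)).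
Hypothesis lA : lin_set A.
Implicit Types f g : X -> F.

Lemma lin_setZ c f : A f -> A (fun x => c * f x).
Proof.
by case: lA => A0 AL Af; have := AL c _ _ Af A0; under eq_fun do rewrite addr0.
Qed.

Lemma lin_setD f g : A f -> A g -> A (fun x => f x + g x).
Proof. by case: lA => A0 AL Af Ag; have := AL 1 _ _ Af Ag; under eq_fun do rewrite mul1r. Qed.

Lemma lin_setB f g : A f -> A g -> A (fun x => f x - g x).
Proof.
case: lA => A0 AL Af Ag; have := AL (-1) _ _ Ag Af.
by under eq_fun do rewrite mulN1r addrC.
Qed.

Lemma lin_setZV c f : c != 0 -> A (fun x => c * f x) -> A f.
Proof. by move=> c0 /(lin_setZ c^-1); under eq_fun do rewrite mulKf//. Qed.

Lemma lin_set_add1 a : lin_set [set f | exists2 g, A g & exists c, f = (fun x => g x + c * a x)].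
Proof.
case: lA => A0 AL; split.
  by exists (fun=> 0) => //; exists 0; apply/funext => x; rewrite mul0r addr0.
move=> c _ _ [f Af [s ->]] [g Ag [t ->]].
exists (fun x => c * f x + g x); first exact: AL.
by exists (c * s + t); apply/funext => x; ring.
Qed.
End LinSet.

Lemma tensor_section_l (F : fieldType) (X Y : Type) (A : set (X -> F)) (B : set (Y -> F)) k y :
  lin_set A -> tensor A B k -> A (k^~ y).
Proof.
move=> lA; elim=> [{}k k0|a b k1 {}k Aa Bb _ IH e].
  have -> : k^~ y = (fun=> 0) by apply/funext => x.
  by case: lA.
have -> : k^~ y = (fun x => b y * a x + k1 x y) by apply/funext => x; rewrite e mulrC.
by case: lA => _; apply.
Qed.

Lemma tensor_section_r (F : fieldType) (X Y : Type) (A : set (X -> F)) (B : set (Y -> F)) k x :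
  lin_set B -> tensor A B k -> B (k x).
Proof. by move=> lB /tensor_swap; exact: tensor_section_l. Qed.

Section Sections.
Variables (F : fieldType) (X Y : Type).
Implicit Types (A : set (X -> F)) (B : set (Y -> F)) (k : X -> Y -> F).

(** Expanding each product of [f + s a] and [g + t b] sorts the terms by whether they involve [a],
    [b], both or neither. *)
Lemma tensor_add1 A B a b k : lin_set A -> lin_set B ->
  tensor [set f | exists2 g, A g & exists c, f = (fun x => g x + c * a x)]
         [set f | exists2 g, B g & exists c, f = (fun y => g y + c * b y)] k ->
  exists p al be c, [/\ tensor A B p, A al, B be &
    forall x y, k x y = p x y + a x * be y + al x * b y + c * a x * b y].
Proof.
move=> lA lB; elim=> [{}k k0|_ _ k1 {}k [f Af [s ->]] [g Bg [t ->]] _ [p [al [be [c [hp ha hb e1]]]]] e].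
  exists (fun _ _ => 0), (fun=> 0), (fun=> 0), 0; split.
  - exact: tensor0.
  - by case: lA.
  - by case: lB.
  - by move=> x y; rewrite k0; ring.
exists (fun x y => f x * g y + p x y), (fun x => t * f x + al x),
  (fun y => s * g y + be y), (s * t + c); split.
- exact: tensorS Af Bg hp _.
- by case: lA => _; apply.
- by case: lB => _; apply.
- by move=> x y; rewrite e e1; ring.
Qed.

(* Peel off one elementary tensor [a (x) b], apply induction to the subspaces
   enlarged by [a] and [b], and use the sections to remove [a] and [b] again. *)
Lemma tensor_of_sections A B k : lin_set A -> lin_set B -> tensor setT setT k ->
  (forall y, A (k^~ y)) -> (forall x, B (k x)) -> tensor A B k.
Proof.
move=> + + h; elim: h A B => [{}k k0|a b k1 {}k _ _ _ IH e] A B lA lB hA hB.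
  exact: tensor0.
have e' x y : k1 x y = k x y - a x * b y by rewrite e; ring.
have tk1 := IH _ _ (lin_set_add1 lA a) (lin_set_add1 lB b).
have [] := tensor_add1 lA lB (tk1 _ _).
- move=> y; exists (k^~ y) => //; exists (- b y); apply/funext => x; rewrite e'; ring.
- move=> x; exists (k x) => //; exists (- a x); apply/funext => y; rewrite e'; ring.
move=> p [al [be [c [hp ha hb e1]]]].
have {}e x y : k x y = p x y + a x * be y + al x * b y + (c + 1) * a x * b y.
  by rewrite e e1; ring.
have pA y : A (p^~ y) by exact: tensor_section_l hp.
have pB x : B (p x) by exact: tensor_section_r hp.
have [Aa|nAa] := pselect (A a).
  have [Bb|nBb] := pselect (B b).
    apply: (tensorS (k := fun x y => a x * ((c + 1) * b y) + (al x * b y + p x y)) Aa hb).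
      apply: tensorS Aa (lin_setZ lB (c + 1) Bb) _ (fun x y => erefl).
      exact: tensorS ha Bb hp (fun x y => erefl).
    by move=> x y; rewrite e; ring.
  (* A nonzero coefficient of [b] in the section at [x] would put [b] in [B]; hence [al] is a
     multiple of [a] and the terms in [b] cancel. *)
  have z x : al x + (c + 1) * a x = 0.
    apply/eqP/negPn/negP => n0; apply: nBb; apply: (lin_setZV lB n0).
    have := lin_setB lB (lin_setB lB (hB x) (pB x)) (lin_setZ lB (a x) hb).
    by congr (B _); apply/funext => y; rewrite e; ring.
  apply: tensorS Aa hb hp _ => x y; rewrite e.
  by have -> : al x = - ((c + 1) * a x); [apply/eqP; rewrite -addr_eq0 z|ring].
(* By the same argument on the other side, [be] is a multiple of [b], and only the term of [al] and
   [b] remains beside [p]. *)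
have z y : be y + (c + 1) * b y = 0.
  apply/eqP/negPn/negP => n0; apply: nAa; apply: (lin_setZV lA n0).
  have := lin_setB lA (lin_setB lA (hA y) (pA y)) (lin_setZ lA (b y) ha).
  by congr (A _); apply/funext => x; rewrite e; ring.
have e2 x y : k x y = al x * b y + p x y.
  by rewrite e; have -> : be y = - ((c + 1) * b y); [apply/eqP; rewrite -addr_eq0 z|ring].
(* Either the remaining term vanishes, or a section where [al] is nonzero shows that [b] lies in
   [B]. *)
have [[x n0]|al0] := pselect (exists x, al x != 0); last first.
  apply: eq_tensor hp _ => x y; rewrite e2; suff -> : al x = 0 by rewrite mul0r add0r.
  by apply/eqP/negPn/negP => n0; apply: al0; exists x.
apply: (tensorS ha _ hp e2); apply: (lin_setZV lB n0).
have := lin_setB lB (hB x) (pB x).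
by congr (B _); apply/funext => y; rewrite e2; ring.
Qed.
End Sections.

(** * Representative functions separate the points of a compact group *)

Section PeterWeyl.
Variables (R : realType) (K : topologicalType).
Variables (mul : K -> K -> K) (inv : K -> K) (one : K).
Hypothesis Hg : is_topological_group mul inv one.
Hypothesis cK : compact [set: K].
Let mulA := tg_mulA Hg.
Let mul1 := tg_mul1g Hg.
Let mulg1 := tg_mulg1 Hg.
Let cmul : continuous (fun p : K * K => mul p.1 p.2) := tg_mul_cts Hg.
Let cinv : continuous inv := tg_inv_cts Hg.

Notation I := (@mean R K mul).
Notation convol := (@convol R K mul inv).
Notation flip := (@flip R K inv).
Notation dot := (@dot R K mul).
Implicit Types f g k : K -> R.

(** The family is padded to all of [nat]; beyond [n] only continuity is asked. *)
Definition orthonormal n (f : nat -> K -> R) : Prop :=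
  (forall i, continuous (f i)) /\
  forall i j, (i < n)%N -> (j < n)%N -> dot (f i) (f j) = (i == j)%:R.

Definition residue n (f : nat -> K -> R) k x := k x - \sum_(i < n) dot k (f i) * f i x.

Lemma residue_cts n (f : nat -> K -> R) k : orthonormal n f -> continuous k -> continuous (residue n f k).
Proof.
move=> [cf _] ck; rewrite /residue.
have ? : continuous (fun x => \sum_(i < n) dot k (f i) * f i x).
  by apply: cts_sum => i; have ? := cf i; cts.
by cts.
Qed.

Lemma dot_residue n (f : nat -> K -> R) k j : orthonormal n f -> continuous k -> (j < n)%N ->
  dot (residue n f k) (f j) = 0.
Proof.
move=> [cf on] ck jn.
have cs (i : 'I_n) : continuous (fun x => dot k (f i) * f i x) by have ? := cf i; cts.
have cS : continuous (fun x => \sum_(i < n) dot k (f i) * f i x) by apply: cts_sum.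
rewrite /residue (dotBl Hg cK)//.
rewrite (dot_suml Hg cK _ (g := fun (i : 'I_n) x => dot k (f i) * f i x))//.
under eq_bigr => i _ do rewrite (dotZl Hg cK (dot k (f i)) (cf i) (cf j)) on//.
rewrite (bigD1 (Ordinal jn))//= eqxx mulr1 big1 ?addr0 ?subrr// => i.
by rewrite -val_eqE /= => /negbTE ->; rewrite mulr0.
Qed.

Lemma bessel n (f : nat -> K -> R) k : orthonormal n f -> continuous k ->
  \sum_(i < n) dot k (f i) ^+ 2 <= dot k k.
Proof.
move=> onf ck; have [cf on] := onf.
have cs (i : 'I_n) : continuous (fun x => dot k (f i) * f i x) by have ? := cf i; cts.
have cS : continuous (fun x => \sum_(i < n) dot k (f i) * f i x) by apply: cts_sum.
have cr := residue_cts onf ck.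
have dS g : continuous g -> dot (fun x => \sum_(i < n) dot k (f i) * f i x) g =
    \sum_(i < n) dot k (f i) * dot (f i) g.
  move=> cg; rewrite (dot_suml Hg cK _ (g := fun (i : 'I_n) x => dot k (f i) * f i x))//.
  by apply: eq_bigr => i _; rewrite (dotZl Hg cK)//; exact: cf.
have rE g : continuous g ->
    dot (residue n f k) g = dot k g - \sum_(i < n) dot k (f i) * dot (f i) g.
  by move=> cg; rewrite -dS// -(dotBl Hg cK).
have := dot_ge0 Hg cK cr; rewrite rE// [X in _ - X]big1 ?subr0; last first.
  by move=> i _; rewrite (dotC mul (f i)) dot_residue ?mulr0.
rewrite (dotC mul) rE//.
under eq_bigr => i _ do rewrite (dotC mul (f i)) -expr2.
by rewrite subr_ge0.
Qed.

Section Eigenspace.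
Variables (psi : K -> R) (l : R).
Hypotheses (cpsi : continuous psi) (l0 : l != 0).

Definition eigen f := continuous f /\ convol psi f = (fun x => l * f x).

Lemma eigen_residue n (f : nat -> K -> R) k : orthonormal n f -> (forall i, eigen (f i)) -> eigen k ->
  eigen (residue n f k).
Proof.
move=> onf ef [ck ek]; split; first exact: residue_cts.
have cf i : continuous (f i) by case: (ef i).
have cs (i : 'I_n) : continuous (fun x => dot k (f i) * f i x) by have ? := cf i; cts.
have cS0 : continuous (fun x => \sum_(i < n) dot k (f i) * f i x) by apply: cts_sum.
have cS : continuous (fun x => -1 * \sum_(i < n) dot k (f i) * f i x) by cts.
have -> : residue n f k = (fun x => k x + -1 * \sum_(i < n) dot k (f i) * f i x).
  by apply/funext => x; rewrite mulN1r.
rewrite (convolDr Hg cK cpsi ck cS) ek (convolZr Hg cK (-1) cpsi cS0).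
rewrite (convol_sumr Hg cK _ cpsi cs); apply/funext => x.
rewrite mulrDr !mulN1r mulrN; congr (_ - _); rewrite mulr_sumr; apply: eq_bigr => i _.
rewrite (convolZr Hg cK (dot k (f i)) cpsi (cf i)).
by case: (ef i) => _ ->; rewrite mulrCA.
Qed.

Lemma eigen_rtrans f y : eigen f -> eigen (fun x => f (mul x y)).
Proof. by move=> [cf ef]; split; [cts|rewrite (convol_rtrans Hg cK)// ef]. Qed.

(** The coefficients of [y -> psi (x y^-1)] along the family are [convol psi (f i) x = l * f i x].
    Bessel bounds the sum of their squares at each [x], and taking the mean over [x] counts the
    family. *)
Lemma orthonormal_eigen_bound n (f : nat -> K -> R)  : orthonormal n f -> (forall i, eigen (f i)) ->
  n%:R * l ^+ 2 <= dot psi psi.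
Proof.
move=> onf ef; have [cf on] := onf.
have h x : \sum_(i < n) (l * f i x) ^+ 2 <= dot psi psi.
  have c : continuous (fun y => psi (mul x (inv y))) by cts.
  have -> : dot psi psi = dot (fun y => psi (mul x (inv y))) (fun y => psi (mul x (inv y))).
    by rewrite /dot (@mean_flip _ _ _ _ _ Hg cK (fun y => psi y * psi y))//; cts.
  apply: le_trans (bessel onf c); apply: ler_sum => i _.
  by case: (ef i) => _ /(congr1 (@^~ x)) <-.
have cs (i : 'I_n) : continuous (fun x => (l * f i x) ^+ 2).
  rewrite (_ : (fun x => _) = (fun x => (l * f i x) * (l * f i x))); last by apply/funext => x.
  by have ? := cf i; cts.
have : I (fun x => \sum_(i < n) (l * f i x) ^+ 2) <= I (fun _ => dot psi psi).
  apply: (mean_le Hg cK) => [||//]; [exact: cts_sum|by cts].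
rewrite (mean_cst Hg cK) (mean_sum Hg cK _ (f := fun (i : 'I_n) x => (l * f i x) ^+ 2))//.
apply: le_trans; rewrite (eq_bigr (fun=> l ^+ 2)); first by rewrite sumr_const card_ord mulr_natl.
move=> i _; under eq_fun do rewrite exprMn expr2 [f i _ ^+ 2]expr2.
have ? := cf i; rewrite (meanZ Hg cK); last by cts.
by have := on i i (ltn_ord i) (ltn_ord i); rewrite /dot eqxx => ->; rewrite mulr1.
Qed.

(* Orthonormal families of eigenfunctions are bounded in size, so a maximal one
   spans all the right translates of [p]. *)
Lemma eigen_translates_tensor p : eigen p -> tensor setT setT (fun x y => p (mul x y)).
Proof.
move=> ep; apply: contrapT => np.
have H n : exists f : nat -> K -> R, orthonormal n f /\ forall i, eigen (f i).
  elim: n => [|n [f [onf ef]]].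
    exists (fun _ _ => 0); split; first by split => // i; cts.
    move=> i; split; first by cts.
    apply/funext => x; rewrite mulr0 /convol.
    by under eq_fun do rewrite mulr0; rewrite (mean_cst Hg cK).
  have [cf on] := onf.
  pose py y x := p (mul x y).
  have epy y : eigen (py y) by exact: eigen_rtrans.
  (* If every right translate of [p] has zero residue, its expansion in the family exhibits finite
     rank. Otherwise a normalized residue extends the family. *)
  have [[y [x gx]]|all0] := pselect (exists y x, residue n f (py y) x != 0); last first.
    exfalso; apply: np.
    apply: eq_tensor (@tensor_sum _ _ _ setT setT n (fun i => f i) (fun i y => dot (py y) (f i)) _) _ => //.
    move=> x y; apply/eqP; rewrite -subr_eq0; apply/negPn/negP => h; apply: all0.
    exists y, x; apply: contra h => /eqP h; rewrite /residue in h; rewrite -[X in _ == X]h.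
    by apply/eqP; congr (_ - _); apply: eq_bigr => i _; rewrite mulrC.
  set g := residue n f (py y) in gx.
  have eg : eigen g by exact: eigen_residue.
  have cg : continuous g by case: eg.
  have gg : 0 < dot g g by exact: (dot_gt0 Hg cK cg gx).
  pose h z := (Num.sqrt (dot g g))^-1 * g z.
  have ch : continuous h by rewrite /h; cts.
  have eh : eigen h.
    split => //; rewrite /h (convolZr Hg cK)//; case: eg => _ ->.
    by apply/funext => z; rewrite mulrCA.
  have hf j : (j < n)%N -> dot h (f j) = 0.
    move=> jn; rewrite /h (dotZl Hg cK)// /g dot_residue ?mulr0//.
    by case: (epy y).
  have hh : dot h h = 1.
    rewrite /h (dotZl Hg cK)// (dotC mul) (dotZl Hg cK)// mulrA -invfM -expr2.
    by rewrite sqr_sqrtr ?ltW// mulVf// gt_eqF.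
  exists (fun i => if (i < n)%N then f i else h); split; last by move=> i; case: ifP.
  split; first by move=> i; case: ifP.
  move=> i j; rewrite !ltnS (leq_eqVlt i) (leq_eqVlt j).
  move=> /orP[/eqP ->|il] /orP[/eqP ->|jl]; rewrite ?ltnn ?il ?jl ?eqxx.
  - exact: hh.
  - by rewrite hf// gtn_eqF.
  - by rewrite (dotC mul) hf// ltn_eqF.
  - exact: on.
have l2 : 0 < l ^+ 2 by rewrite exprn_even_gt0.
(* A size chosen to exceed the bound of [orthonormal_eigen_bound]. *)
have [f [onf ef]] := H (Num.bound (dot psi psi / l ^+ 2)).
have := orthonormal_eigen_bound onf ef.
have := archi_boundP (divr_ge0 (dot_ge0 Hg cK cpsi) (ltW l2)).
by rewrite ltr_pdivrMr// ltNge => /negbTE ->.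
Qed.
End Eigenspace.

Lemma convol0r f : convol f (fun=> 0) = fun=> 0.
Proof.
apply/funext => x; rewrite /convol; under eq_fun do rewrite mulr0.
exact: (mean_cst Hg cK).
Qed.

(* With [theta x = alpha (h x) - alpha x] and [chi = theta~ * theta], an
   eigenfunction [p] of [chi * chi] satisfies [theta * p != 0], which says that
   [alpha * p] is not invariant under left translation by [h]. *)
Theorem compact_group_separation h : hausdorff_space K -> h <> one ->
  exists u : K -> R, [/\ continuous u, u h != u one &
    tensor setT setT (fun x y => u (mul x y))].
Proof.
move=> hK h1.
have [alpha [ca ah]] : exists alpha : K -> R, continuous alpha /\ alpha h != alpha one.
  have := compact_normal hK cK => /(@normal_separatorP R) /(_ [set h] [set one]).
  have cl (x : K) : closed [set x] by exact: (accessible_closed_set1 (hausdorff_accessible hK)).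
  have h10 : [set h] `&` [set one] = set0 by apply/seteqP; split => // x [/= -> /h1].
  move=> /(_ (cl _) (cl _) h10) /(@uniform_separatorP _ R) [f [cf _ f0 f1]].
  exists f; split => //.
  have -> : f h = 0 by apply: f0; exists h.
  have -> : f one = 1 by apply: f1; exists one.
  by rewrite eq_sym oner_neq0.
pose theta x := alpha (mul h x) - alpha x.
have ct : continuous theta by rewrite /theta; cts.
have cft := flip_cts Hg ct.
pose chi := convol (flip theta) theta.
have cc : continuous chi by exact: (convol_cts Hg cK).
have fc : flip chi = chi by rewrite (flip_convol Hg cK)// (flipK Hg).
have chi1 : chi one != 0.
  rewrite /chi -(dotE Hg) gt_eqF//; apply: (dot_gt0 Hg cK (x := one)) => //.
  by rewrite /theta mulg1 subr_eq0.
have [l [p [l0 cp p1 ep]]] := exists_eigenfunction Hg cK cc fc chi1.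
have cps : continuous (convol chi chi) by exact: (convol_cts Hg cK).
have tp : tensor setT setT (fun x y => p (mul x y)).
  by apply: (@eigen_translates_tensor (convol chi chi) l); rewrite ?gt_eqF.
(* Otherwise associativity gives [chi * chi * p = chi * theta~ * (theta * p) = 0], against the
   nonzero value [l * p one]. *)
have [x tx] : exists x, convol theta p x != 0.
  apply: contrapT => n0; have z : convol theta p = fun=> 0.
    by apply/funext => x; apply/eqP/negPn/negP => nx; apply: n0; exists x.
  have : convol chi (convol (convol (flip theta) theta) p) one = l * p one.
    by rewrite -(convolA Hg cK) ?ep.
  rewrite (convolA Hg cK cft ct cp) z !convol0r => /esym/eqP.
  by rewrite mulf_eq0 (negbTE p1) gt_eqF.
pose u := convol alpha p.
have cu : continuous u by exact: (convol_cts Hg cK).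
have tu : tensor setT setT (fun x y => u (mul x y)).
  (* The left factors must be continuous before they can be convolved with [alpha]; the sections of
     the kernel ensure this. *)
  have tcp : tensor [set f : K -> R | continuous f] setT (fun x y => p (mul x y)).
    apply: tensor_of_sections => //= [|y]; last by cts.
    by split => [|c f g cf cg] /=; cts.
  have [n [a [b [ca' e]]]] := tensor_ordP tcp.
  have ca'' i : continuous (a i) by case: (ca' i).
  apply: eq_tensor (@tensor_sum _ _ _ setT setT n (fun i => convol alpha (a i)) b _) _ => // s t.
  have cs i : continuous (fun z => b i t * a i z) by have ? := ca'' i; cts.
  rewrite /u -(congr1 (@^~ s) (convol_rtrans Hg cK t ca cp)) /=.
  rewrite (_ : (fun z => p (mul z t)) = (fun z => \sum_(i < n) b i t * a i z)); last first.
    by apply/funext => z; rewrite e; apply: eq_bigr => i _; rewrite mulrC.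
  rewrite (convol_sumr Hg cK _ ca cs); apply: eq_bigr => i _.
  by rewrite (convolZr Hg cK)// mulrC.
(* The difference of the values at [h] and [one] is [u (h x) - u x], which is [convol theta p x]. *)
exists (fun y => u (mul y x)); split; first by cts.
- rewrite mul1 -subr_eq0; move: tx; rewrite /theta (convolBl Hg cK)//; last by cts.
  by rewrite (convol_ltrans Hg).
- by have := tensor_comp id (fun y => mul y x) tu; under eq_fun do under eq_fun do rewrite mulA.
Qed.
End PeterWeyl.

(** * Compactly supported functions on a locally compact group *)

Lemma compact_set_type (X : topologicalType) (A : set X) :
  compact A -> compact [set: set_type A].
Proof.
move=> cA F FF _.
have FA : (set_val @ F) A.
  have : F setT by exact: filterT.
  change (F setT -> F (set_val @^-1` A)).
  by apply: filterS => x _; exact: set_valP.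
have [x [Ax clx]] := cA (set_val @ F) _ FA.
exists (exist _ x (mem_set Ax)); split => // U V FU.
rewrite nbhsE => -[B [[W oW <-] Bx] BV].
have [] := clx (set_val @` U) W.
- by move: FU; change (F U -> F (set_val @^-1` (set_val @` U))); apply: filterS => y Uy; exists y.
- exact: open_nbhs_nbhs.
by move=> _ [[y Uy <-] Wy]; exists y; split => //; exact: BV.
Qed.

Lemma hausdorff_set_type (X : topologicalType) (A : set X) :
  hausdorff_space X -> hausdorff_space (set_type A).
Proof.
move=> hX p q clpq; apply: val_inj; apply: (hX (set_val p) (set_val q)) => U V nU nV.
have cv : continuous (set_val : set_type A -> X) by exact: initial_continuous.
have [y [Uy Vy]] := clpq _ _ (cv p U nU) (cv q V nV).
by exists (set_val y).
Qed.

Section Subgroup.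
Variables (G : topologicalType) (mul : G -> G -> G) (inv : G -> G) (one : G).
Variable H : set G.
Hypothesis Hg : is_topological_group mul inv one.
Hypothesis Hs : is_subgroup mul inv one H.

Lemma subgroup_mulP (x y : set_type H) : mul (set_val x) (set_val y) \in H.
Proof. by case: Hs => _ hm _; apply/mem_set/hm; exact: set_valP. Qed.

Lemma subgroup_invP (x : set_type H) : inv (set_val x) \in H.
Proof. by case: Hs => _ _ hi; apply/mem_set/hi; exact: set_valP. Qed.

Definition sub_mul (x y : set_type H) : set_type H := exist (fun z => z \in H) _ (subgroup_mulP x y).
Definition sub_inv (x : set_type H) : set_type H := exist (fun z => z \in H) _ (subgroup_invP x).
Definition sub_one : set_type H :=
  exist (fun z => z \in H) one (mem_set (let: And3 h _ _ := Hs in h)).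

Lemma sub_topological_group : is_topological_group sub_mul sub_inv sub_one.
Proof.
have cv : continuous (set_val : set_type H -> G) by exact: initial_continuous.
case: Hg => mA m1 mV cm ci; split.
- by move=> x y z; apply: val_inj; exact: mA.
- by move=> x; split; apply: val_inj; [exact: (m1 _).1|exact: (m1 _).2].
- by move=> x; split; apply: val_inj; [exact: (mV _).1|exact: (mV _).2].
- apply: continuous_comp_initial.
  rewrite /comp /=.
  have : continuous (fun p : set_type H * set_type H => mul (set_val p.1) (set_val p.2)) by cts.
  exact.
- apply: continuous_comp_initial.
  have : continuous (fun p : set_type H => inv (set_val p)) by cts.
  exact.
Qed.
End Subgroup.

Lemma conj_continuous (C : numClosedFieldType) : continuous (fun z : C => z^*).
Proof.
move=> z; apply/(@cvgrPdist_le _ _ _ (nbhs z) (nbhs_filter z)) => e e0.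
have /(@cvgrPdist_le _ _ _ (nbhs z) (nbhs_filter z)) /(_ _ e0) :
  (fun y : C => y) @ nbhs z --> z by exact: cvg_id.
by apply: filterS => y; rewrite -rmorphB norm_conjC.
Qed.

Section PG.
Variables (R : realType) (K : topologicalType).
Variables (mul : K -> K -> K) (inv : K -> K) (one : K).
Hypothesis Hg : is_topological_group mul inv one.
Hypothesis hK : hausdorff_space K.
Let mulA := tg_mulA Hg.
Let mul1 := tg_mul1g Hg.
Let mulV := tg_mulVg Hg.
Let cmul : continuous (fun p : K * K => mul p.1 p.2) := tg_mul_cts Hg.
Let cinv : continuous inv := tg_inv_cts Hg.
Let mulK := tg_mulgK Hg.
Let mulVK := tg_mulgVK Hg.
Let mulKV := tg_mulKg Hg.
Let mulVKl := tg_mulVKg Hg.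
Let invM := tg_invM Hg.
Let invK := tg_invK Hg.

Implicit Types f g : K -> CC R.
Notation cos := (is_compact_open_subgroup mul inv one).
Notation PG := (@PG R K mul inv one).

Lemma cos_closed H : cos H -> closed H.
Proof. by case=> _ cH _; exact: compact_closed. Qed.

Lemma cosI H H' : cos H -> cos H' -> cos (H `&` H').
Proof.
move=> hH hH'; have cH := cos_closed hH'; case: hH => -[h1 hm hi] cpt oH.
case: hH' => -[h1' hm' hi'] _ oH'; split.
- split => [//|x y [? ?] [? ?]|x [? ?]]; split; [exact: hm|exact: hm'|exact: hi|exact: hi'].
- exact: compact_closedI.
- exact: openI.
Qed.

Lemma cos_conj H a : cos H -> cos [set x | H (mul (inv a) (mul x a))].
Proof.
case=> -[h1 hm hi] cpt oH; split.
- split => /= [|x y hx hy|x hx].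
  + by rewrite mul1 mulV.
  + by have := hm _ _ hx hy; rewrite -!mulA mulVKl.
  + by have := hi _ hx; rewrite !invM invK mulA.
- have -> : [set x | H (mul (inv a) (mul x a))] = (fun x => mul a (mul x (inv a))) @` H.
    apply/seteqP; split => [x /= hx|_ [x hx <-] /=].
      by exists (mul (inv a) (mul x a)) => //; rewrite -mulA mulVKl mulK.
    by rewrite -mulA mulVK mulKV.
  apply: continuous_compact => //; apply: continuous_subspaceT.
  by cts.
- apply: (open_comp (f := fun x => mul (inv a) (mul x a))) => // x _.
  have c : continuous (fun x => mul (inv a) (mul x a)) by cts.
  exact: c.
Qed.

(** Left multiplication by [H'] then preserves each coset [a H] with [a] in [s]. *)
Lemma cos_conjs H (s : seq K) : cos H ->
  exists2 H', cos H' & forall a, a \in s -> forall h, H' h -> H (mul (inv a) (mul h a)).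
Proof.
move=> hH; elim: s => [|a s [H' hH' h']]; first by exists H.
exists (H' `&` [set x | H (mul (inv a) (mul x a))]).
  by apply: cosI => //; exact: cos_conj.
by move=> b; rewrite inE => /orP[/eqP -> h []//|bs h [+ _]]; exact: h'.
Qed.

Lemma ind_cts (H : set K) : open H -> closed H ->
  continuous (fun x : K => (x \in H)%:R : CC R).
Proof.
move=> oH cH x; apply: cvg_near_cst; have [xH|xH] := pselect (H x).
  have : nbhs x H by exact: open_nbhs_nbhs.
  by apply: filterS => y yH; rewrite !mem_set.
have : nbhs x (~` H) by apply: open_nbhs_nbhs; split => //; exact: closed_openC.
by apply: filterS => y yH; rewrite !memNset.
Qed.

Lemma CcP f : Cc f <-> continuous f /\ exists2 S, compact S & forall x, ~ S x -> f x = 0.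
Proof.
split=> [[cf cS]|[cf [S cS h]]]; split => //.
  exists (closure [set x | f x != 0]) => // x nx; apply/eqP/negPn/negP => fx.
  by apply: nx; exact: subset_closure.
have clS := compact_closed hK cS.
apply: (subclosed_compact _ cS); first exact: closed_closure.
rewrite (closure_id S).1//; apply: closure_subset => x /= fx.
by apply: contrapT => /h; move/eqP: fx.
Qed.

Lemma Cc_lin : lin_set (@Cc R K).
Proof.
split; first by apply/CcP; split; [cts|exists set0 => //; exact: compact0].
move=> c f g /CcP[cf [S cS hS]] /CcP[cg [T cT hT]]; apply/CcP; split; first by cts.
exists (S `|` T); first exact: compactU.
by move=> x /not_orP[/hS -> /hT ->]; rewrite mulr0 addr0.
Qed.

Lemma CcM f g : Cc f -> continuous g -> Cc (fun x => f x * g x).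
Proof.
move=> /CcP[cf [S cS hS]] cg; apply/CcP; split; first by cts.
by exists S => // x /hS ->; rewrite mul0r.
Qed.

Lemma Cc_comp f (phi psi : K -> K) : continuous phi -> continuous psi ->
  cancel phi psi -> Cc f -> Cc (fun x => f (phi x)).
Proof.
move=> cphi cpsi e /CcP[cf [S cS hS]]; apply/CcP; split; first by cts.
exists (psi @` S); first by apply: continuous_compact => //; exact: continuous_subspaceT.
by move=> x nx; apply: hS => Sx; apply: nx; exists (phi x).
Qed.

Lemma Cc_rtrans f a : Cc f -> Cc (fun x => f (mul x a)).
Proof.
apply: (@Cc_comp _ _ (fun x => mul x (inv a))); [cts|cts|].
by move=> x; rewrite mulK.
Qed.

Lemma Cc_ltrans f a : Cc f -> Cc (fun x => f (mul a x)).
Proof.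
have c b : continuous (fun x => mul b x) by cts.
by apply: (Cc_comp (c a) (c (inv a))) => x /=; rewrite mulKV.
Qed.

Lemma Cc_inv f : Cc f -> Cc (fun x => f (inv x)).
Proof. by apply: (@Cc_comp _ _ inv); [cts|cts|]; exact: invK. Qed.

Lemma conj_cts f : continuous f -> continuous (fun x => (f x)^*).
Proof. by move=> cf; apply: (cts_comp (@conj_continuous (CC R))). Qed.

Lemma Cc_conj f : Cc f -> Cc (fun x => (f x)^*).
Proof.
move=> /CcP[cf [S cS hS]]; apply/CcP; split; first exact: conj_cts.
by exists S => // x /hS ->; rewrite rmorph0.
Qed.
End PG.

(** * The algebra P(G) *)

Local Opaque CC.

Lemma cts_lin (F : numFieldType) (X : topologicalType) :
  lin_set [set f : X -> F | continuous f].
Proof.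
split=> [|c f g cf cg]; first exact: cts_cst.
have : continuous (fun x => c * f x + g x) by cts.
by [].
Qed.

Section PGclosure.
Variables (R : realType) (K : topologicalType).
Variables (mul : K -> K -> K) (inv : K -> K) (one : K).
Hypothesis Hg : is_topological_group mul inv one.
Hypothesis hK : hausdorff_space K.
Let mulA := tg_mulA Hg.
Let mulV := tg_mulVg Hg.
Let cmul : continuous (fun p : K * K => mul p.1 p.2) := tg_mul_cts Hg.
Let cinv : continuous inv := tg_inv_cts Hg.
Let mulK := tg_mulgK Hg.
Let mulVK := tg_mulgVK Hg.
Let mulKV := tg_mulKg Hg.
Let mulVKl := tg_mulVKg Hg.
Let invM := tg_invM Hg.
Let invK := tg_invK Hg.

Implicit Types f g : K -> CC R.
Notation cos := (is_compact_open_subgroup mul inv one).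
Notation PG := (@PG R K mul inv one).

(** The indicator of [H] extends the restricted kernel by zero, so that finite rank is stated on all
    of [K]. *)
Definition coset_kernel f (H : set K) : K -> K -> CC R :=
  fun x h => (h \in H)%:R * f (mul x h).

(* Sections of the kernel are in [C_c(G)] and continuous, so the continuity
   requirements on the [f_i] and [phi_i] are automatic. *)
Lemma PGP f : PG f <->
  Cc f /\ exists2 H, cos H & tensor setT setT (coset_kernel f H).
Proof.
split=> [[cf [H [hH [n [fi [phi [hfp e]]]]]]]|[cf [H hH tH]]]; split=> //; exists H.
  exact: hH.
  apply: eq_tensor (@tensor_sum _ _ _ setT setT n fi (fun i h => (h \in H)%:R * phi i h) _) _ => //.
  move=> x h; rewrite /coset_kernel; have [hh|nh] := boolP (h \in H).
    by rewrite mul1r e; [apply: eq_bigr => i _; rewrite mul1r|exact: set_mem].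
  by rewrite mul0r big1// => i _; rewrite mul0r mulr0.
split=> //; have cH := cos_closed hK hH; have oH : open H by case: hH.
have cind := @ind_cts R K H oH cH; have [cf' _] := cf.
have : tensor (@Cc R K) [set g : K -> CC R | continuous g] (coset_kernel f H).
  apply: tensor_of_sections tH _ _.
  - exact: Cc_lin.
  - exact: cts_lin.
  - by move=> y; apply: (lin_setZ (Cc_lin _ hK)); exact: (Cc_rtrans Hg hK).
  - move=> x; have : continuous (fun h => (h \in H)%:R * f (mul x h)) by cts.
    exact.
move=> /tensor_ordP[n [a [b [hab e]]]]; exists n, a, b; split.
  by move=> i; have [Ha Hb] := hab i; split; [exact: Ha|exact: continuous_subspaceT].
by move=> x h hh; rewrite -e /coset_kernel mem_set// mul1r.
Qed.

Lemma coset_kernel_sub f H H' : H' `<=` H -> tensor setT setT (coset_kernel f H) ->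
  tensor setT setT (coset_kernel f H').
Proof.
move=> HH t; apply: eq_tensor (tensor_scale (fun=> 1) (fun h => (h \in H')%:R) t) _ => x h.
rewrite /coset_kernel mul1r mulrA; congr (_ * _).
have [h1|h1] := boolP (h \in H'); last by rewrite mul0r.
by rewrite mul1r mem_set//; apply: HH; exact: set_mem.
Qed.

Lemma PG2P f g : PG f -> PG g -> [/\ Cc f, Cc g & exists H,
  [/\ cos H, tensor setT setT (coset_kernel f H) & tensor setT setT (coset_kernel g H)]].
Proof.
move=> /PGP[cf [H hH t]] /PGP[cg [H' hH' t']]; split => //; exists (H `&` H'); split.
- exact: cosI.
- by apply: coset_kernel_sub t.
- by apply: coset_kernel_sub t'.
Qed.

Lemma PG_Cc f : PG f -> Cc f. Proof. by case. Qed.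

Lemma PG_lin : (exists H, cos H) -> lin_set PG.
Proof.
move=> [H0 hH0]; split.
  apply/PGP; split; first exact: (Cc_lin R hK).1.
  by exists H0 => //; apply: tensor0 => x y; rewrite /coset_kernel mulr0.
move=> c f g Pf Pg; have [cf cg [H [hH t t']]] := PG2P Pf Pg.
apply/PGP; split; first exact: (Cc_lin R hK).2.
exists H => //; apply: eq_tensor (tensorD (tensor_scale (fun=> c) (fun=> 1) t) t') _ => x y.
by rewrite /coset_kernel; ring.
Qed.

Lemma PG_mul f g : PG f -> PG g -> PG (fun x => f x * g x).
Proof.
move=> Pf Pg; have [cf cg [H [hH t t']]] := PG2P Pf Pg.
apply/PGP; split; first by apply: CcM => //; case: cg.
exists H => //; apply: eq_tensor (tensorM t t') _ => x y.
by rewrite /coset_kernel; case: (y \in H); rewrite ?mul1r ?mul0r.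
Qed.

Lemma PG_conj f : PG f -> PG (fun x => (f x)^*).
Proof.
move=> /PGP[cf [H hH t]]; apply/PGP; split; first exact: Cc_conj.
exists H => //; apply: eq_tensor (tensor_rmorph Num.conj t) _ => x y.
by rewrite /coset_kernel rmorphM rmorph_nat.
Qed.

(** From [x h a = (x a) (a^-1 h a)], the subgroup is replaced by a conjugate. *)
Lemma PG_rtrans f a : PG f -> PG (fun x => f (mul x a)).
Proof.
move=> /PGP[cf [H hH t]]; apply/PGP; split; first exact: (Cc_rtrans Hg).
exists [set h | H (mul (inv a) (mul h a))]; first exact: (cos_conj Hg).
apply: eq_tensor (tensor_comp (fun x => mul x a) (fun h => mul (inv a) (mul h a)) t) _ => x h.
rewrite /coset_kernel -!mulA mulVKl; congr (_%:R * _).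
Qed.

Lemma PG_ltrans f a : PG f -> PG (fun x => f (mul a x)).
Proof.
move=> /PGP[cf [H hH t]]; apply/PGP; split; first exact: (Cc_ltrans Hg).
exists H => //; apply: eq_tensor (tensor_comp (fun x => mul a x) id t) _ => x h.
by rewrite /coset_kernel mulA.
Qed.

Lemma Cc_finite_lcosets f H : Cc f -> cos H -> exists s : seq K,
  forall x, (exists2 a, a \in s & H (mul (inv a) x)) \/ f x = 0.
Proof.
move=> /(CcP hK)[cf [S cS hS]] [[h1 _ _] _ oH].
have hV a : S a -> nbhs a ((fun x => mul (inv a) x) @^-1` H).
  have c : continuous (fun x => mul (inv a) x) by cts.
  by move=> _; apply: (c a); rewrite mulV; exact: open_nbhs_nbhs.
have [s hs] := compact_finite_nbhs cS hV; exists s => x.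
by have [/hs|/hS] := pselect (S x); [left|right].
Qed.

Lemma Cc_finite_rcosets f H : Cc f -> cos H -> exists s : seq K,
  forall x, (exists2 a, a \in s & H (mul x (inv a))) \/ f x = 0.
Proof.
move=> cf hH; have [s hs] := Cc_finite_lcosets (Cc_inv Hg hK cf) hH.
exists (map inv s) => x; have := hs (inv x); rewrite invK => -[[a sa ha]|]; last by right.
left; exists (inv a); first exact: map_f.
by case: hH => -[_ _ hi] _ _; have := hi _ ha; rewrite invM !invK.
Qed.

(* The support of [f] meets finitely many cosets [a H]; on [a H] the kernel is
   [f (h x) = f ((h a) (a^-1 x))], and [H'] is chosen to preserve each [a H]. *)
Lemma PG_left_kernel f : PG f ->
  exists2 H, cos H & tensor setT setT (fun h x => (h \in H)%:R * f (mul h x)).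
Proof.
move=> /PGP[cf [H hH t]]; have [s hs] := Cc_finite_lcosets cf hH.
have [H' hH' hc] := cos_conjs Hg hK s hH; exists H' => //.
have [[_ hm hi] _ _] := hH; have [[_ _ hi'] _ _] := hH'.
apply: (@tensor_coverr _ _ _ _ s (fun a => [set x | H (mul (inv a) x)])) => [x|a sa].
  have [[a sa ha]|nx] := pselect (exists2 a, a \in s & H (mul (inv a) x)).
    by left; exists a.
  right => h; have [/set_mem h1|_] := boolP (h \in H'); last by rewrite mul0r.
  have [[a sa ha]|->] := hs (mul h x); last by rewrite mulr0.
  exfalso; apply: nx; exists a => //.
  (* If [h x] lies in [a H] with [h] in [H'], then [x] lies in [h^-1 a H = a H]. *)
  have := hm _ _ (hc _ sa _ (hi' _ h1)) ha.
  by rewrite -!mulA mulVKl mulKV.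
apply: eq_tensor (tensor_scale (fun h => (h \in H')%:R) (fun=> 1)
  (tensor_comp (fun h => mul h a) (fun x => mul (inv a) x) t)) _ => h x.
rewrite /coset_kernel -mulA mulVKl mulr1 mulrCA; congr (_ * (_%:R * _)).
Qed.

(** Inversion turns [x h] into [h^-1 x^-1], so the left kernel of [f] is needed, with its variables
    exchanged. *)
Lemma PG_inv f : PG f -> PG (fun x => f (inv x)).
Proof.
move=> Pf; have [H hH t] := PG_left_kernel Pf; apply/PGP.
split; first by apply: (Cc_inv Hg hK); case: Pf.
exists H => //; apply: eq_tensor (tensor_swap (tensor_comp inv inv t)) _ => x h.
have [[_ _ hi] _ _] := hH; rewrite /coset_kernel invM.
suff -> : (h \in H) = (inv h \in H) by [].
by apply/idP/idP => /set_mem hh; apply/mem_set; have := hi _ hh; rewrite ?invK.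
Qed.

(** The support of [g] meets finitely many cosets [a H], and there [f (x y) = f ((x a) (a^-1 y))]
    with [a^-1 y] in [H]. *)
Lemma PG_delta_tensor f g : PG f -> PG g ->
  tensor setT setT (fun x y => f (mul x y) * g y).
Proof.
move=> /PGP[cf [H hH t]] Pg; have [s hs] := Cc_finite_lcosets (PG_Cc Pg) hH.
apply: (@tensor_coverr _ _ _ _ s (fun a => [set y | H (mul (inv a) y)])) => [y|a sa].
  by have [|->] := hs y; [left|right => x; rewrite mulr0].
apply: eq_tensor (tensor_scale (fun=> 1) g
  (tensor_comp (fun x => mul x a) (fun y => mul (inv a) y) t)) _ => x y.
by rewrite /coset_kernel -mulA mulVKl mul1r [RHS]mulrCA [g y * _]mulrC.
Qed.

(** With [f'] the composite of [f] and [inv], [f (x y^-1)] is [f' ((y a^-1) (a x^-1))]; on the right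
    coset [H a] this is the left kernel of [f']. *)
Lemma PG_codelta_tensor f g : PG f -> PG g ->
  tensor setT setT (fun x y => f (mul x (inv y)) * g y).
Proof.
move=> Pf Pg; have [H hH t] := PG_left_kernel (PG_inv Pf).
have [s hs] := Cc_finite_rcosets (PG_Cc Pg) hH.
apply: (@tensor_coverr _ _ _ _ s (fun a => [set y | H (mul y (inv a))])) => [y|a sa].
  by have [|->] := hs y; [left|right => x; rewrite mulr0].
apply: eq_tensor (tensor_scale (fun=> 1) g (tensor_swap
  (tensor_comp (fun y => mul y (inv a)) (fun x => mul a (inv x)) t))) _ => x y.
by rewrite mulA mulVK invM invK mul1r [RHS]mulrCA [g y * _]mulrC.
Qed.

Lemma PG_delta_span : (exists H, cos H) -> delta_span mul PG = alg_tensor PG.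
Proof.
move=> /PG_lin lPG; apply/seteqP; split => F.
- move=> [n [c [f [g [hfg ->]]]]].
  have : tensor PG PG (fun x y => \sum_(i < n) c i * (f i (mul x y) * g i y)).
    apply: tensor_bigsum => i; have [Pf Pg] := hfg i.
    have t : tensor PG PG (fun x y => f i (mul x y) * g i y).
      apply: (tensor_of_sections lPG lPG (PG_delta_tensor Pf Pg)) => [y|x].
        have := lin_setZ lPG (g i y) (PG_rtrans y Pf).
        by congr (PG _); apply/funext => x; rewrite mulrC.
      exact: PG_mul (PG_ltrans x Pf) Pg.
    have [m [a [b [hab e]]]] := tensor_ordP t.
    apply: eq_tensor (@tensor_sum _ _ _ PG PG m (fun j x => c i * a j x) b _) _.
      by move=> j; have [? ?] := hab j; split => //; exact: lin_setZ.
    by move=> x y; rewrite e mulr_sumr; apply: eq_bigr => j _; rewrite mulrA.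
  move=> /tensor_ordP[m [a [b [hab e]]]]; exists m, a, b; split => //.
  by apply/funext => x; apply/funext => y; exact: e.
- move=> [n [a [b [hab ->]]]].
  have : tensor PG PG (fun x y => \sum_(i < n) a i (mul x (inv y)) * b i y).
    apply: tensor_bigsum => i; have [Pa Pb] := hab i.
    apply: (tensor_of_sections lPG lPG (PG_codelta_tensor Pa Pb)) => [y|x].
      have := lin_setZ lPG (b i y) (PG_rtrans (inv y) Pa).
      by congr (PG _); apply/funext => x; rewrite mulrC.
    have := PG_mul (PG_rtrans (inv x) (PG_inv Pa)) Pb.
    by congr (PG _); apply/funext => y; rewrite invM invK.
  (* Evaluating the decomposition of [a(x y^-1) b(y)] at [(x y, y)] gives [a(x) b(y)] as a sum of
     terms [p(x y) q(y)]. *)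
  move=> /tensor_ordP[m [p [q [hpq e]]]]; exists m, (fun=> 1), p, q; split => //.
  apply/funext => x; apply/funext => y; have := e (mul x y) y.
  rewrite mulK => ->.
  by apply: eq_bigr => i _; rewrite mul1r.
Qed.
End PGclosure.

(** * Transfer of separating functions from a compact open subgroup *)

Definition toCC (R : realType) (r : R) : CC R := real_complex R r.

Lemma normr_toCC (R : realType) (x : R) : `|toCC x| = toCC `|x|.
Proof. by rewrite /toCC normc_def /= expr0n addr0 sqrtr_sqr. Qed.

Lemma toCC_cts (R : realType) : continuous (@toCC R).
Proof.
move=> x; apply/(@cvgrPdist_le _ _ _ (nbhs x) (nbhs_filter x)) => e e0.
(* Positivity in the order of the complex numbers forces [e] to be real. *)
have := e0; rewrite ltcE /= => /andP[/eqP ei er].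
have : \forall y \near x, `|x - y| <= complex.Re e.
  by apply: (@cvgrPdist_le _ _ _ (nbhs x) (nbhs_filter x) (fun y : R => y) x).1 er; exact: cvg_id.
apply: filterS => y h.
have -> : toCC x - toCC y = toCC (x - y) by rewrite /toCC rmorphB.
rewrite normr_toCC /toCC.
have -> : e = real_complex R (complex.Re e) by case: (e) ei => a b /= ->.
by rewrite lecR.
Qed.

Section ExtendByZero.
Variables (R : realType) (K : topologicalType) (H : set K).

Definition ext0 (u : set_type H -> CC R) (x : K) : CC R :=
  if insub x is Some y then u y else 0.

Lemma ext0_in u x (h : x \in H) : ext0 u x = u (exist (fun z => z \in H) x h).
Proof. by rewrite /ext0 (insubT (fun z => z \in H) h). Qed.

Lemma ext0_notin u x : x \notin H -> ext0 u x = 0.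
Proof. by move=> h; rewrite /ext0 insubN. Qed.

Lemma ext0_cts u : open H -> closed H -> continuous u -> continuous (ext0 u).
Proof.
move=> oH cH cu x; have [xH|xH] := boolP (x \in H); last first.
  rewrite /continuous_at ext0_notin//; apply: cvg_near_cst.
  have : nbhs x (~` H).
    by apply: open_nbhs_nbhs; split; [exact: closed_openC|move/mem_set; exact/negP].
  by apply: filterS => y yH; rewrite ext0_notin// memNset.
move=> W nW; rewrite (ext0_in u xH) in nW.
have := cu _ _ nW; rewrite /= {1}/nbhs /= => -[B [[W' oW' <-] Bx] BV].
have : nbhs x (W' `&` H).
  by apply: open_nbhs_nbhs; split; [exact: openI|split => //; exact: set_mem].
rewrite /=; apply: filterS => z [W'z /mem_set zH]; rewrite /= (ext0_in u zH).
exact: (BV (exist (fun z => z \in H) z zH) W'z).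
Qed.
End ExtendByZero.

Section Separation.
Variables (R : realType) (K : topologicalType).
Variables (mul : K -> K -> K) (inv : K -> K) (one : K).
Hypothesis Hg : is_topological_group mul inv one.
Hypothesis hK : hausdorff_space K.
Let mulK := tg_mulgK Hg.

Notation cos := (is_compact_open_subgroup mul inv one).
Notation PG := (@PG R K mul inv one).

(** For [h] in [H], [f (x h)] vanishes unless [x] is in [H], so cutting off [x] as well leaves the
    coset kernel unchanged. *)
Lemma PG_supported (f : K -> CC R) H : cos H -> continuous f -> (forall x, ~ H x -> f x = 0) ->
  tensor setT setT (fun x h => (x \in H)%:R * (h \in H)%:R * f (mul x h)) -> PG f.
Proof.
move=> hH cf f0 t; have [[h1 hm hi] cH oH] := hH; apply/(PGP Hg hK); split.
  by apply/(CcP hK); split => //; exists H.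
exists H => //; apply: eq_tensor t _ => x h; rewrite /coset_kernel.
have [xH|xH] := boolP (x \in H); first by rewrite mul1r.
rewrite mul0r mul0r; have [hh|hh] := boolP (h \in H); last by rewrite mul0r.
rewrite f0 ?mulr0// => xh; move/negP: xH; apply; apply/mem_set.
by have := hm _ _ xh (hi _ (set_mem hh)); rewrite mulK.
Qed.

(** Outside [H] the indicator of [H] separates; inside, a representative function of the compact
    group [H], extended by zero, does. *)
Lemma PG_separates_one H h : cos H -> h <> one -> exists f : K -> CC R, PG f /\ f h <> f one.
Proof.
move=> hH h1; have [[H1 hm hi] cH oH] := hH; have clH := cos_closed hK hH.
have [hh|nh] := pselect (H h); last first.
  exists (fun x => (x \in H)%:R); split; last first.
    by rewrite memNset// mem_set//; apply/eqP; rewrite eq_sym oner_neq0.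
  apply: PG_supported hH (ind_cts oH clH) _ _ => [x xH|]; first by rewrite memNset.
  apply: eq_tensor (@tensor1 _ _ _ setT setT (fun x => (x \in H)%:R) (fun h => (h \in H)%:R) I I) _.
  move=> x y; have [/set_mem xH|] := boolP (x \in H); last by rewrite !mul0r.
  have [/set_mem yH|] := boolP (y \in H); last by rewrite !(mulr0, mul0r).
  by rewrite mem_set ?mulr1//; exact: hm.
have Hs : is_subgroup mul inv one H by [].
have Hsg := sub_topological_group Hg Hs.
pose h' : set_type H := exist (fun z => z \in H) h (mem_set hh).
have h'1 : h' <> sub_one Hs by move=> /(congr1 set_val) /h1.
have [u [cu uh tu]] := @compact_group_separation R _ _ _ _ Hsg (compact_set_type cH) h'
  (hausdorff_set_type (A := H) hK) h'1.
pose f := ext0 (fun y : set_type H => toCC (u y)).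
exists f; split.
  apply: PG_supported hH _ _ _.
  - by apply: ext0_cts => //; exact: (cts_comp (@toCC_cts R) cu).
  - by move=> x xH; rewrite /f ext0_notin// memNset.
  have t := tensor_rmorph (real_complex R : {rmorphism R -> CC R}) tu.
  have [n [a [b [_ e]]]] := tensor_ordP t.
  apply: eq_tensor (@tensor_sum _ _ _ setT setT n (fun i => ext0 (a i)) (fun i => ext0 (b i)) _) _ => //.
  move=> x y; have [xH|xH] := boolP (x \in H); last first.
    by rewrite !mul0r big1// => i _; rewrite ext0_notin// mul0r.
  have [yH|yH] := boolP (y \in H); last first.
    by rewrite mulr0 mul0r big1// => i _; rewrite [X in _ * X]ext0_notin// mulr0.
  pose x' : set_type H := exist (fun z => z \in H) x xH.
  pose y' : set_type H := exist (fun z => z \in H) y yH.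
  rewrite !mul1r /f (ext0_in _ (subgroup_mulP Hs x' y')).
  apply: (etrans (e x' y')).
  by apply: eq_bigr => i _; rewrite (ext0_in _ xH) (ext0_in _ yH).
rewrite /f (ext0_in _ (mem_set hh)) (ext0_in _ (mem_set H1)) => /complexI ue.
move/eqP: uh; apply; rewrite /h' ue; congr u; exact: val_inj.
Qed.
End Separation.

Theorem theorem3p7 (R : realType) (G : topologicalType)
  (mul : G -> G -> G) (inv : G -> G) (one : G) :
  is_locally_compact_group mul inv one ->
  (exists H : set G, is_compact_open_subgroup mul inv one H) ->
  [/\ is_multiplier_hopf_star_subalgebra mul inv (@PG R G mul inv one),
      separates_points (@PG R G mul inv one),
      (forall (x : G) (f : G -> CC R), @PG R G mul inv one f ->
         @PG R G mul inv one (fun y => f (mul (inv x) y))) &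
      (forall (x : G) (f : G -> CC R), @PG R G mul inv one f ->
         @PG R G mul inv one (fun y => f (mul y x)))].
Proof.
move=> [Hg hG _] hH; have lPG := PG_lin R Hg hG hH.
split; last 2 first.
- by move=> x f; exact: PG_ltrans.
- by move=> x f; exact: PG_rtrans.
- split.
  + move=> f /PG_Cc /(CcP hG)[cf [S cS hS]]; split => // e e0.
    by exists S; split => // x /hS ->; rewrite normr0 ltcR.
  + split.
    * by case: lPG.
    * by move=> f g; exact: lin_setD.
    * by move=> c f; exact: lin_setZ.
    * by move=> f g; exact: PG_mul.
    * by move=> f; exact: PG_conj.
  + by move=> f; exact: PG_inv.
  + exact: PG_delta_span.
- move=> x y xy; have [H cH] := hH.
  have [mulA mul1 mulV _ _] := Hg.
  (* Left translation by [x^-1] reduces the pair [x], [y] to [one], [x^-1 y]. *)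
  have n1 : mul (inv x) y <> one.
    move=> e; apply: xy.
    by rewrite -[y](mul1 y).1 -(mulV x).2 -mulA e (mul1 x).2.
  have [f [Pf fn]] := @PG_separates_one R _ _ _ _ Hg hG H _ cH n1.
  exists (fun z => f (mul (inv x) z)); split; first exact: PG_ltrans.
  by rewrite (mulV x).1 => /esym.
Qed.
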